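(* Let $p$ be a prime, let $q$ be a power of $p$ (with $q>1$), and let $\Bbbk$ be an algebraically closed field of characteristic $p$. Let $B\subset\mathbb{P}^2$ be the Ballico-Hefez curve, let $\gamma_{q^2+q+1}:\mathbb{P}^2\to\mathbb{P}^2$ be the morphism $[x_0:x_1:x_2]\mapsto[x_0^{q^2+q+1}:x_1^{q^2+q+1}:x_2^{q^2+q+1}]$, and let $C_0\subset\mathbb{P}^2$ be the Fermat curve of degree $q^2+q+1$, defined by $x_0^{q^2+q+1}+x_1^{q^2+q+1}+x_2^{q^2+q+1}=0$. Then (i) the dual curve $C_0^{\vee}$ is $\gamma_{q^2+q+1}^{-1}(B)$; and (ii) the singularities of $C_0^{\vee}$ consist of $(q^2+q+1)^2(q^2-q)/2$ ordinary nodes, and $3(q^2+q+1)$ singular points with Milnor number $q^2(q+1)$.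
   Context: For a positive integer $d$, $\gamma_d:\mathbb{P}^2\to\mathbb{P}^2$ denotes the morphism $\gamma_d([x_0:x_1:x_2])=[x_0^d:x_1^d:x_2^d]$. Let $l_0\subset\mathbb{P}^2$ be the line $x_0+x_1+x_2=0$. The Ballico-Hefez curve $B$ is the image $\gamma_{q+1}(l_0)$ of the line $l_0$ under $\gamma_{q+1}$. The dual curve $C^{\vee}$ of a plane curve $C=\{F=0\}$ is the image (as a reduced curve) of the Gauss map $C\to(\mathbb{P}^2)^{\vee}$, $[x_0:x_1:x_2]\mapsto\left[\frac{\partial F}{\partial x_0}:\frac{\partial F}{\partial x_1}:\frac{\partial F}{\partial x_2}\right]$; here the dual plane $(\mathbb{P}^2)^{\vee}$ is identified with $\mathbb{P}^2$ by means of the dual homogeneous coordinates. For a formal power series $f\in\Bbbk[[x,y]]$, the Milnor number is $\mu(f)=\dim_{\Bbbk}\Bbbk[[x,y]]/\left(\frac{\partial f}{\partial x},\frac{\partial f}{\partial y}\right)$; the Milnor number of a singular point of a plane curve is the Milnor number of a local defining equation of the curve in affine coordinates centred at that point. *)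

(* Defs.v *)
From HB Require Import structures.
From mathcomp Require Import all_boot all_order all_algebra.
From mathcomp Require Import generic_quotient.
From mathcomp Require Import mpoly.

Set Implicit Arguments.
Unset Strict Implicit.
Unset Printing Implicit Defensive.

Import GRing.Theory.
Local Open Scope ring_scope.
Local Open Scope quotient_scope.

Section ProjectivePlane.
Variable k : fieldType.

Definition nzvec := {v : 'rV[k]_3 | v != 0}.

(* Equality of row spaces: for nonzero row vectors, v = c u with c != 0. *)
Definition proportional (u v : nzvec) : bool := (val u == val v)%MS.

Lemma proportional_refl : reflexive proportional.
Proof. by move=> u; rewrite /proportional !submx_refl. Qed.

Lemma proportional_sym : ssrbool.symmetric proportional.
Proof. by move=> u v; rewrite /proportional andbC. Qed.

Lemma proportional_trans : transitive proportional.
Proof.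
move=> v u w /andP[uv vu] /andP[vw wv].
by rewrite /proportional (submx_trans uv vw) (submx_trans wv vu).
Qed.

Canonical proportional_equiv :=
  EquivRel proportional proportional_refl proportional_sym proportional_trans.

(* Since (P^2)^dual is identified with P^2 through the dual coordinates, the
   same type serves for both planes. *)
Definition P2 := {eq_quot proportional}.
HB.instance Definition _ := Choice.on P2.

Definition point (v : 'rV[k]_3) (v_neq0 : v != 0) : P2 :=
  \pi_{eq_quot proportional} (exist (fun w : 'rV[k]_3 => w != 0) v v_neq0).

(* A choice of homogeneous coordinates; it is only used in expressions that
   are insensitive to rescaling. *)
Definition coords (P : P2) : 'rV[k]_3 := val (repr P).

Lemma pow_coords_neq0 (d : nat) (P : P2) :
  (\row_i coords P 0 i ^+ d : 'rV[k]_3) != 0.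
Proof.
have /rV0Pn[i nz_i] : coords P != 0 by exact: (valP (repr P)).
by apply/rV0Pn; exists i; rewrite mxE expf_neq0.
Qed.

Definition gamma (d : nat) (P : P2) : P2 := point (pow_coords_neq0 d P).

Definition image (f : P2 -> P2) (C : P2 -> Prop) (Q : P2) : Prop :=
  exists2 P, C P & Q = f P.

Definition preimage (f : P2 -> P2) (C : P2 -> Prop) (P : P2) : Prop := C (f P).

(* Meaningful for homogeneous F. *)
Definition on_curve (F : {mpoly k[3]}) (P : P2) : Prop :=
  F.@[fun i => coords P 0 i] = 0.

Definition gradient (F : {mpoly k[3]}) (P : P2) : 'rV[k]_3 :=
  \row_i (F^`M(i)).@[fun j => coords P 0 j].

(* Image of the Gauss map on the points of F = 0 where it is defined. No
   Zariski closure is taken: for a smooth curve the Gauss map is a morphism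
   and its image is already closed. *)
Definition dual_curve (F : {mpoly k[3]}) (Q : P2) : Prop :=
  exists2 P, on_curve F P & exists grad_neq0 : gradient F P != 0,
                              Q = point grad_neq0.

(* F = 0 is the reduced plane curve with underlying point set C: C is the zero
   locus of F, and F generates the homogeneous vanishing ideal of C. *)
Definition reduced_equation (C : P2 -> Prop) (F : {mpoly k[3]}) : Prop :=
  [/\ F != 0,
      exists2 d : nat, (0 < d)%N & F \is d.-homog,
      forall P, C P <-> on_curve F P
    & forall (d : nat) (G : {mpoly k[3]}), G \is d.-homog ->
        (forall P, C P -> on_curve G P) -> exists H, G = H * F].

Definition singular_point (F : {mpoly k[3]}) (P : P2) : Prop :=
  on_curve F P /\ gradient F P = 0.

(* F in the affine chart x_i = 1, translated so that P becomes the origin: the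
   coordinate x_(lift i a) is P_(lift i a) / P_i + 'X_a, for a = 0, 1. *)
Definition local_equation (F : {mpoly k[3]}) (P : P2) (i : 'I_3) :
    {mpoly k[2]} :=
  F \mPo [tuple if unlift i j is Some a
                then (coords P 0 j / coords P 0 i)%:MP + 'X_a
                else 1 | j < 3].

End ProjectivePlane.

Section PowerSeries.
Variable k : fieldType.

(* k[[x, y]]: f i j is the coefficient of x^i y^j. *)
Definition series2 := nat -> nat -> k.

Definition series2_of_mpoly (f : {mpoly k[2]}) : series2 :=
  fun i j => f@_[multinom [tuple i; j]].

Definition mul2 (f g : series2) : series2 :=
  fun i j => \sum_(a < i.+1) \sum_(b < j.+1) f a b * g (i - a)%N (j - b)%N.

Definition dx (f : series2) : series2 := fun i j => f i.+1 j *+ i.+1.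
Definition dy (f : series2) : series2 := fun i j => f i j.+1 *+ j.+1.

Definition jacobian_ideal (f h : series2) : Prop :=
  exists a b : series2,
    forall i j, h i j = mul2 a (dx f) i j + mul2 b (dy f) i j.

(* dim k[[x, y]] / (df/dx, df/dy) = m: the quotient has a basis formed by the
   classes of m series. *)
Definition milnor_number (f : series2) (m : nat) : Prop :=
  exists g : 'I_m -> series2, forall h : series2,
    exists! c : 'rV[k]_m,
      jacobian_ideal f (fun i j => h i j - \sum_(l < m) c 0 l * g l i j).

(* Multiplicity two, with quadratic part (a x + b y) (c x + d y) a product of
   two non-proportional linear forms (valid in every characteristic). *)
Definition ordinary_node (f : series2) : Prop :=
  [/\ f 0%N 0%N = 0, f 1%N 0%N = 0, f 0%N 1%N = 0
    & exists a b c d : k,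
        [/\ a * d - b * c != 0, f 2%N 0%N = a * c,
           f 1%N 1%N = a * d + b * c & f 0%N 2%N = b * d]].

End PowerSeries.

Section Singularities.
Variable k : fieldType.

(* A local property is required in every standard affine chart that contains
   P, so that no chart has to be chosen. *)
Definition ordinary_node_at (F : {mpoly k[3]}) (P : P2 k) : Prop :=
  forall i, coords P 0 i != 0 ->
    ordinary_node (series2_of_mpoly (local_equation F P i)).

Definition milnor_number_at (F : {mpoly k[3]}) (P : P2 k) (m : nat) : Prop :=
  forall i, coords P 0 i != 0 ->
    milnor_number (series2_of_mpoly (local_equation F P i)) m.

End Singularities.

Section Curves.
Variable k : fieldType.

Definition line0 : {mpoly k[3]} := \sum_(i < 3) 'X_i.

Definition fermat (n : nat) : {mpoly k[3]} := \sum_(i < 3) 'X_i ^+ n.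

Definition ballico_hefez (q : nat) : P2 k -> Prop :=
  image (gamma q.+1) (on_curve line0).

End Curves.

(* Main.v *)
Require Import Defs.
From mathcomp Require Import all_boot all_order all_algebra.
From mathcomp Require Import generic_quotient separable mpoly ring zify.

Set Implicit Arguments.
Unset Strict Implicit.
Unset Printing Implicit Defensive.

Import GRing.Theory.
Local Open Scope ring_scope.

(** Write N = q + 1 and n = q^2 + q + 1, so that n - 1 = q N and both N and n
    are 1 in the field.

    The Gauss map of the Fermat curve raises the coordinates to the power q N.
    The q-power map is additive and bijective, hence the dual curve consists of
    the points w such that w_i^n = a_i^N for some a on the line
    a_0 + a_1 + a_2 = 0 ([on_curve_dual]).  The preimage of the Ballico-Hefez
    curve B has the same description ([on_curve_BH]), which is the first
    assertion.

    Equation.  Above X = a^N and Y = b^N, the points of B have last coordinate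
    (a + z b)^N with z in the group mu_N of N-th roots of unity.  As z^q = z^-1,
    this is X + Y + z (a^q b) + z^-1 (a b^q).  The product over mu_N of Z minus
    these values is D_N(Z - X - Y, X Y) - X^q Y - X Y^q, where D_N is the
    Dickson polynomial: D_N(u + v, u v) = u^N + v^N ([bh_prod]).  This form
    [bh] makes sense over every commutative ring, and the dual curve is the zero
    locus of F = bh (x_0^n) (x_1^n) (x_2^n), called [dual_eq].  It is monic
    in x_2 of degree n N and has n N distinct roots x_2 for general x_0, x_1
    ([generic_fiber]); dividing by F shows that it generates the homogeneous
    ideal of the dual curve ([dual_eq_generates]).

    Points with nonzero coordinates.  The polynomial bh (a^N) (b^N) (c^N) is a
    product of N^2 linear forms c - e (a + z b) ([bh_lines]).  Moreover
    x^n = x^N * x^(q^2), and x^(q^2) differs from its value at a point only by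
    terms of order q^2, at least 4.  So, up to terms of order 3, F looks
    near such a point like a product of lines in rescaled coordinates.  The
    point is singular iff two of these lines contain it ([torus_gradient]).
    For the lines c = a + b and c = e (a + z b), this forces t = b / a to
    satisfy t^q = z t: thus t lies in F_(q^2) but not in F_q, the pair (z, e) is
    determined by t, and the two lines have different tangents
    ([second_line]); the point is an ordinary node ([node_at]).  In terms of t,
    (w_i^n) is proportional to (1, t^N, (1 + t)^N), where t^N and (1 + t)^N are
    norms from F_(q^2) to F_q: t is determined up to conjugation
    ([norm_pair_fiber]).  There are (q^2 - q) / 2 conjugate pairs, and n^2
    points w for each of them.

    Points on a coordinate axis.  One has bh X Y Z = (X - Y)^N + Z E with E
    nonzero at (1, 1, 0), and similarly for the other two axes ([bh_edge]).
    Let x and y be affine coordinates such that x = 0 is the axis and y vanishes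
    at the point.  Then F is (y * unit)^N + x^n * E locally, and as n = N = 1 in
    the field, its partial derivatives are y^q * unit + x^(n-1) * (...) and
    x^(n-1) * unit ([edge_derivatives]).  They generate the ideal
    (y^q, x^(n-1)), whose colength q (n - 1) = q^2 (q + 1) is the Milnor number
    ([milnor_x], [milnor_y]). *)

(** * Dickson polynomials and the equation of the Ballico-Hefez curve *)

(** Defined over any ring, by the recursion of the power sums of the two roots
    of T^2 - W T + P. *)
Fixpoint dickson (R : comNzRingType) (W P : R) (m : nat) : R :=
  match m with
  | 0 => 2%:R
  | m1.+1 => match m1 with
             | 0 => W
             | m2.+1 => W * dickson W P m1 - P * dickson W P m2
             end
  end.

Definition bh (R : comNzRingType) (q : nat) (X Y Z : R) : R :=
  dickson (Z - X - Y) (X * Y) q.+1 - X ^+ q * Y - X * Y ^+ q.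

Lemma dicksonSS (R : comNzRingType) (W P : R) m :
  dickson W P m.+2 = W * dickson W P m.+1 - P * dickson W P m.
Proof. by []. Qed.

Lemma nat_ind2 (P : nat -> Prop) :
  P 0%N -> P 1%N -> (forall m, P m -> P m.+1 -> P m.+2) -> forall m, P m.
Proof.
move=> P0 P1 PS m; suff [] : P m /\ P m.+1 by [].
by elim: m => // m [Pm Pm1]; split=> //; apply: PS.
Qed.

Lemma dickson_sum (R : comNzRingType) (u v : R) m :
  dickson (u + v) (u * v) m = u ^+ m + v ^+ m.
Proof.
elim/nat_ind2: m => [||m IH0 IH1]; rewrite ?dicksonSS ?IH0 ?IH1 //.
by rewrite !exprS; ring.
Qed.

Lemma rmorph_dickson (R S : comNzRingType) (f : {rmorphism R -> S}) W P m :
  f (dickson W P m) = dickson (f W) (f P) m.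
Proof.
elim/nat_ind2: m => [||m IH0 IH1]; rewrite ?dicksonSS ?rmorphB ?rmorphM ?IH0 ?IH1 //.
exact: rmorph_nat.
Qed.

Lemma rmorph_bh (R S : comNzRingType) (f : {rmorphism R -> S}) q X Y Z :
  f (bh q X Y Z) = bh q (f X) (f Y) (f Z).
Proof. by rewrite /bh !(rmorphB, rmorphM, rmorphXn, rmorph_dickson). Qed.

(** Enough closure to pass to any polynomial expression: it serves both for
    congruences modulo terms of order 3 and for first derivatives at a point. *)
Definition ring_congruence (R : comNzRingType) (E : R -> R -> Prop) :=
  [/\ forall x, E x x,
      forall x x' y y', E x x' -> E y y' -> E (x - y) (x' - y') &
      forall x x' y y', E x x' -> E y y' -> E (x * y) (x' * y')].

Lemma dickson_cong (R : comNzRingType) (E : R -> R -> Prop) W W' P P' m :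
  ring_congruence E -> E W W' -> E P P' -> E (dickson W P m) (dickson W' P' m).
Proof.
move=> [E0 EB EM] EW EP; elim/nat_ind2: m => [||m IH0 IH1] //.
by rewrite !dicksonSS; apply: EB; apply: EM.
Qed.

Lemma bh_cong (R : comNzRingType) (E : R -> R -> Prop) q X X' Y Y' Z Z' :
    ring_congruence E -> E X X' -> E Y Y' -> E Z Z' ->
  E (bh q X Y Z) (bh q X' Y' Z').
Proof.
move=> E_cong EX EY EZ; have [E0 EB EM] := E_cong.
have EXn m x x' : E x x' -> E (x ^+ m) (x' ^+ m).
  by move=> Ex; elim: m => [|m IH]; rewrite ?expr0 // !exprS; apply: EM.
rewrite /bh; apply: (EB _ _ _ _ _ (EM _ _ _ _ EX (EXn _ _ _ EY))).
apply: (EB _ _ _ _ _ (EM _ _ _ _ (EXn _ _ _ EX) EY)).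
by apply: dickson_cong => //; [apply: (EB _ _ _ _ (EB _ _ _ _ EZ EX)) | apply: EM].
Qed.

Lemma bhC (R : comNzRingType) q (X Y Z : R) : bh q X Y Z = bh q Y X Z.
Proof.
by rewrite /bh (mulrC X Y) (_ : Z - X - Y = Z - Y - X); [ring|rewrite addrAC].
Qed.

(** * Roots in an algebraically closed field *)

Section Closed.
Variable k : closedFieldType.

Definition nroots (N : nat) (x : k) : seq k :=
  sval (closed_field_poly_normal ('X^N - x%:P)).

Definition nroot (N : nat) (x : k) : k := head 0 (nroots N x).

Variable N : nat.
Hypothesis N_gt0 : (0 < N)%N.

Lemma nroots_prodE x : \prod_(z <- nroots N x) ('X - z%:P) = 'X^N - x%:P.
Proof.
rewrite /nroots; case: closed_field_poly_normal => r /= def_r.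
by rewrite [RHS]def_r lead_coefXnsubC // scale1r.
Qed.

Lemma mem_nroots x y : (y \in nroots N x) = (y ^+ N == x).
Proof.
by rewrite -root_prod_XsubC nroots_prodE rootE !hornerE subr_eq0.
Qed.

Lemma size_nroots x : size (nroots N x) = N.
Proof.
by apply/eqP; rewrite -eqSS -(size_prod_XsubC _ id) nroots_prodE size_XnsubC.
Qed.

Lemma prod_nroots x t : \prod_(z <- nroots N x) (t - z) = t ^+ N - x.
Proof.
transitivity ('X^N - x%:P).[t]; last by rewrite !hornerE.
by rewrite -nroots_prodE horner_prod; apply: eq_bigr => z _; rewrite !hornerE.
Qed.

Lemma nrootK x : nroot N x ^+ N = x.
Proof.
apply/eqP; rewrite -mem_nroots /nroot.
by case: (nroots N x) (size_nroots x) N_gt0 => [<-//|z s] _ _; apply: mem_head.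
Qed.

Lemma uniq_nroots x : N%:R != 0 :> k -> x != 0 -> uniq (nroots N x).
Proof.
move=> N0 x0; rewrite -separable_prod_XsubC nroots_prodE.
rewrite unlock; apply/Bezout_eq1_coprimepP; exists (- x^-1%:P, (N%:R * x)^-1 *: 'X) => /=.
rewrite derivB derivXn derivC subr0 -scaler_nat -scalerAr -scalerAl -exprS.
rewrite prednK // scalerA invfM mulVKf //.
by rewrite mulNr mulrBr -polyCM mulVf // opprB mul_polyC subrK.
Qed.

Lemma unity_neq0 z : z \in nroots N 1 -> z != 0.
Proof.
rewrite mem_nroots; apply: contraTneq => ->.
by rewrite expr0n eqn0Ngt N_gt0 eq_sym oner_eq0.
Qed.

Lemma prod_unity u v : \prod_(z <- nroots N 1) (u - z * v) = u ^+ N - v ^+ N.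
Proof.
have [->|v0] := eqVneq v 0.
  rewrite (eq_bigr (fun=> u)) => [|z _]; last by rewrite mulr0 subr0.
  by rewrite big_const_seq count_predT size_nroots iter_mulr_1 expr0n eqn0Ngt N_gt0 subr0.
rewrite (eq_bigr (fun z => v * (u / v - z))) => [|z _]; last first.
  by rewrite mulrBr mulrCA mulfV // mulr1 (mulrC z).
rewrite big_split /= prod_nroots big_const_seq count_predT size_nroots.
by rewrite iter_mulr_1 expr_div_n mulrBr mulrCA mulfV ?expf_neq0 // !mulr1.
Qed.

Lemma prod_unityV u v : N%:R != 0 :> k ->
  \prod_(z <- nroots N 1) (u - z^-1 * v) = u ^+ N - v ^+ N.
Proof.
move=> N0; rewrite -prod_unity -(big_map (@GRing.inv k) xpredT (fun z => u - z * v)).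
have uN : uniq (nroots N 1) by rewrite uniq_nroots ?oner_neq0.
apply/perm_big/uniq_perm => //; first by rewrite (map_inj_uniq invr_inj).
move=> z; apply/mapP/idP => [[y + ->]|].
  by rewrite !mem_nroots exprVn => /eqP->; rewrite invr1.
by exists z^-1; rewrite ?invrK // mem_nroots exprVn -(inj_eq invr_inj) invrK invr1 -mem_nroots.
Qed.

End Closed.

(** * The norm formula *)

Section Frobenius.
Variables (R : comNzRingType) (q : nat).
Hypotheses (q_gt1 : (1 < q)%N) (q_char : [pchar R].-nat q).
Implicit Types x y : R.

Lemma exprqD x y : (x + y) ^+ q = x ^+ q + y ^+ q.
Proof. exact: exprDn_pchar. Qed.

Lemma exprqN x : (- x) ^+ q = - x ^+ q.
Proof.
have := exprqD x (- x); rewrite subrr expr0n eqn0Ngt (ltnW q_gt1) /= => /esym/eqP.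
by rewrite addrC addr_eq0 => /eqP.
Qed.

Lemma exprqB x y : (x - y) ^+ q = x ^+ q - y ^+ q.
Proof. by rewrite exprqD exprqN. Qed.

Lemma exprqSN x : (- x) ^+ q.+1 = x ^+ q.+1.
Proof. by rewrite !exprSr exprqN mulrNN. Qed.

End Frobenius.

Section Curve.
Variables (k : closedFieldType) (q : nat).
Hypotheses (q_gt1 : (1 < q)%N) (q_char : [pchar k].-nat q).

Local Notation N := q.+1.
Local Notation n := (q ^ 2 + q + 1)%N.

Lemma natq0 : q%:R = 0 :> k.
Proof.
have [p p_pr p_q] : exists2 p, prime p & (p %| q)%N.
  by exists (pdiv q); [apply: pdiv_prime | apply: pdiv_dvd].
have p_char : p \in [pchar k].
  by apply: (pnatPpi q_char); rewrite mem_primes p_pr p_q (ltnW q_gt1).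
by case/dvdnP: p_q => r ->; rewrite natrM (pcharf0 p_char) mulr0.
Qed.

Lemma natN1 : N%:R = 1 :> k. Proof. by rewrite -natr1 natq0 add0r. Qed.
Lemma natn1 : n%:R = 1 :> k.
Proof. by rewrite !natrD natrX natq0 expr0n /= !add0r. Qed.
Lemma natN_neq0 : N%:R != 0 :> k. Proof. by rewrite natN1 oner_neq0. Qed.
Lemma natn_neq0 : n%:R != 0 :> k. Proof. by rewrite natn1 oner_neq0. Qed.
Lemma n_gt0 : (0 < n)%N. Proof. by rewrite addn1. Qed.

Lemma unity_exprq (z : k) : z \in nroots N 1 -> z ^+ q = z^-1.
Proof.
move=> zN; have z0 := unity_neq0 (ltn0Sn _) zN.
by move: zN; rewrite mem_nroots // exprSr => /eqP/(canRL (mulfK z0)); rewrite mul1r.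
Qed.

Lemma exprN_add_unity (a b z : k) : z \in nroots N 1 ->
  (a + z * b) ^+ N = a ^+ N + b ^+ N + z * (a ^+ q * b) + z^-1 * (a * b ^+ q).
Proof.
move=> zN; have z0 := unity_neq0 (ltn0Sn _) zN.
rewrite exprSr (exprqD q_char) exprMn (unity_exprq zN) !exprSr.
by field.
Qed.

(** Write W = Z - X - Y as u + v with u v = al be.  Each factor
    W - z al - z^-1 be, multiplied by u, becomes (u - z al) (u - z^-1 be), so
    the product over the roots of unity is computed by [prod_unity]. *)
Lemma bh_prod (a b Z : k) :
  bh q (a ^+ N) (b ^+ N) Z = \prod_(z <- nroots N 1) (Z - (a + z * b) ^+ N).
Proof.
have split_W : exists u, (u - (Z - a ^+ N - b ^+ N)) * u + a ^+ N * b ^+ N = 0.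
  have [u hu] := @solve_monicpoly k 2
    (fun i => if i == 0%N then - (a ^+ N * b ^+ N) else Z - a ^+ N - b ^+ N) isT.
  exists u; move: hu; rewrite big_ord_recl big_ord1 /= expr0 expr1 => hu.
  by rewrite mulrBl -expr2 hu; ring.
have [u hu] := split_W; set W := Z - _ - _ in hu.
pose v := W - u; pose al := a ^+ q * b; pose be := a * b ^+ q.
have uv : u * v = al * be.
  rewrite /v /al /be [RHS](_ : _ = a ^+ N * b ^+ N) ?exprSr; last by ring.
  by rewrite -!exprSr; apply/eqP; rewrite -subr_eq0 -oppr_eq0 -hu; apply/eqP; ring.
have Wuv : W = u + v by rewrite addrC subrK.
have albe : al * be = a ^+ N * b ^+ N by rewrite /al /be !exprSr; ring.
have bhE : bh q (a ^+ N) (b ^+ N) Z = u ^+ N + v ^+ N - al ^+ N - be ^+ N.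
  rewrite /bh -/W -albe -uv {1}Wuv dickson_sum /al /be !exprMn -!exprM.
  by rewrite (mulnC q).
rewrite bhE; transitivity (\prod_(z <- nroots N 1) (u + v - z * al - z^-1 * be)); last first.
  apply: eq_big_seq => z zN; rewrite (exprN_add_unity _ _ zN) -Wuv /W /al /be; ring.
have main (u' v' : k) : u' != 0 -> u' * v' = al * be ->
   u' ^+ N + v' ^+ N - al ^+ N - be ^+ N
     = \prod_(z <- nroots N 1) (u' + v' - z * al - z^-1 * be).
  move=> u0 uv'; apply: (mulfI (expf_neq0 N u0)).
  transitivity ((u' ^+ N - al ^+ N) * (u' ^+ N - be ^+ N)).
    have : u' ^+ N * v' ^+ N = al ^+ N * be ^+ N by rewrite -!exprMn uv'.
    by move: (u' ^+ N) (v' ^+ N) (al ^+ N) (be ^+ N) => x y c d h; ring: h.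
  rewrite -(prod_unity (ltn0Sn q)) -(prod_unityV (ltn0Sn q) _ _ natN_neq0).
  rewrite -big_split /=.
  have -> : u' ^+ N = \prod_(z <- nroots N (1 : k)) u'.
    by rewrite big_const_seq count_predT size_nroots // iter_mulr_1.
  rewrite -big_split /=.
  apply: eq_big_seq => z zN; have z0 := unity_neq0 (ltn0Sn _) zN.
  rewrite !mulrDr uv'; by field.
(* By symmetry v may replace u as the nonzero root; if u = v = 0 then al or be
   vanishes and the product is explicit. *)
have [u0|] := eqVneq u 0; last by move=> u0; apply: main.
have [v0|] := eqVneq v 0; last first.
  move=> v0; rewrite (addrC (u ^+ N)).
  rewrite (eq_bigr (fun z => v + u - z * al - z^-1 * be)) => [|z _]; last by rewrite (addrC v).
  by apply: main; rewrite // mulrC.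
have z0N : 0 ^+ N = 0 :> k by rewrite expr0n.
have := uv; rewrite u0 mul0r => /esym/eqP; rewrite mulf_eq0 => /orP[]/eqP->.
  rewrite v0 !z0N !addr0 subr0 sub0r.
  rewrite (eq_bigr (fun z => 0 - z^-1 * be)) => [|z _]; last by rewrite mulr0 subr0.
  by rewrite (prod_unityV (ltn0Sn q) _ _ natN_neq0) z0N sub0r.
rewrite v0 !z0N !addr0 subr0 sub0r.
rewrite (eq_bigr (fun z => 0 - z * al)) => [|z _]; last by rewrite mulr0 subr0.
by rewrite (prod_unity (ltn0Sn q)) z0N sub0r.
Qed.

Lemma bh_eq0P (X Y Z : k) :
  reflect (exists a b, [/\ X = a ^+ N, Y = b ^+ N & Z = (a + b) ^+ N])
          (bh q X Y Z == 0).
Proof.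
pose a := nroot N X; pose b := nroot N Y.
have Xa : X = a ^+ N by rewrite nrootK.
have Yb : Y = b ^+ N by rewrite nrootK.
apply: (iffP idP) => [|[a' [b' [-> -> ->]]]]; last first.
  rewrite bh_prod prodf_seq_eq0; apply/hasP; exists 1.
    by rewrite mem_nroots // expr1n.
  by rewrite mul1r subrr /=.
rewrite Xa Yb bh_prod prodf_seq_eq0 => /hasP[z zN].
rewrite subr_eq0 => /eqP->; exists a, (z * b); split=> //.
by move: zN; rewrite mem_nroots // exprMn => /eqP ->; rewrite mul1r.
Qed.

End Curve.

(** * The dual curve as a set *)

Notation i0 := (@Ordinal 3 0 isT).
Notation i1 := (@Ordinal 3 1 isT).
Notation i2 := (@Ordinal 3 2 isT).

Lemma ord3P (i : 'I_3) : [\/ i = i0, i = i1 | i = i2].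
Proof.
by case: i => [[|[|[|//]]] ?]; [constructor 1|constructor 2|constructor 3]; apply: val_inj.
Qed.

Lemma forall_ord3 (P : 'I_3 -> Prop) : P i0 -> P i1 -> P i2 -> forall i, P i.
Proof. by move=> P0 P1 P2 i; case: (ord3P i) => ->. Qed.

Lemma sum3E (V : nmodType) (f : 'I_3 -> V) : \sum_(i < 3) f i = f i0 + f i1 + f i2.
Proof.
rewrite !big_ord_recl big_ord0 addr0 addrA.
by congr (f _ + f _ + f _); apply: val_inj.
Qed.

Section Points.
Variable k : fieldType.
Implicit Types (P Q : P2 k) (v w : 'rV[k]_3).

Lemma point_eqP v w (v0 : v != 0) (w0 : w != 0) :
  reflect (exists c, v = c *: w) (point v0 == point w0).
Proof.
rewrite /point eqmodE /=; apply: (iffP andP) => [[/sub_rVP//]|[c vcw]].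
have c0 : c != 0 by apply: contraNneq v0 => c0; rewrite vcw c0 scale0r.
split; apply/sub_rVP; first by exists c.
by exists c^-1; rewrite /= vcw scalerA mulVf // scale1r.
Qed.

Lemma coords_neq0 P : coords P != 0. Proof. exact: (valP (repr P)). Qed.

Lemma point_coords P : point (coords_neq0 P) = P.
Proof.
rewrite -[RHS]reprK /point /coords; congr pi; exact: val_inj.
Qed.

Lemma coords_point v (v0 : v != 0) : exists2 c, c != 0 & coords (point v0) = c *: v.
Proof.
have /eqP/point_eqP[c vc] := point_coords (point v0).
exists c => //; apply: contraTneq (coords_neq0 (point v0)) => c0.
by rewrite vc c0 scale0r eqxx.
Qed.

Lemma row3_neq0 v i : v 0 i != 0 -> v != 0.
Proof. by apply: contraNneq => ->; rewrite mxE. Qed.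

End Points.

Lemma mderiv_exp (R : comNzRingType) m (p : {mpoly R[m]}) i d :
  (p ^+ d)^`M(i) = (p ^+ d.-1 * p^`M(i)) *+ d.
Proof.
elim: d => [|d IH]; first by rewrite expr0 mulr0n -mpolyC1 mderivC.
rewrite exprS mderivM IH /=; case: d {IH} => [|d]; first by rewrite !expr0 mulr0n mulr0 addr0 mulr1 mul1r.
by rewrite /= [in RHS]mulrS mulrnAr mulrA -exprS [p^`M(i) * _]mulrC.
Qed.

Lemma mderiv_var (R : comNzRingType) m (i j : 'I_m) :
  ('X_i : {mpoly R[m]})^`M(j) = ((i == j)%:R)%:MP.
Proof.
rewrite mderivX mnm1E; case: eqP => [->|_]; last by rewrite scale0r mpolyC0.
by rewrite scale1r (_ : U_(j) - U_(j) = 0)%MM ?mpolyX0 //; apply/mnmP => h; rewrite mnmBE subnn mnm0E.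
Qed.

Lemma mderiv_Xn (R : comNzRingType) m (i j : 'I_m) d :
  (('X_i ^+ d : {mpoly R[m]})^`M(j)) = ((i == j) * d)%:R *: 'X_i ^+ d.-1.
Proof.
by rewrite mderiv_exp mderiv_var mulrC mul_mpolyC natrM -scaler_nat scalerA mulrC.
Qed.

Section DualCurve.
Variables (k : closedFieldType) (q : nat).
Hypotheses (q_gt1 : (1 < q)%N) (q_char : [pchar k].-nat q).

Local Notation N := q.+1.
Local Notation n := (q ^ 2 + q + 1)%N.
Implicit Types (P Q : P2 k) (v w : 'rV[k]_3).

Definition dual_eq : {mpoly k[3]} := bh q ('X_i0 ^+ n) ('X_i1 ^+ n) ('X_i2 ^+ n).

Lemma meval_dual_eq (v : 'I_3 -> k) :
  dual_eq.@[v] = bh q (v i0 ^+ n) (v i1 ^+ n) (v i2 ^+ n).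
Proof. by rewrite /dual_eq rmorph_bh /= !rmorphXn /= !mevalXU. Qed.

Lemma dual_eqP (v : 'I_3 -> k) :
  reflect (exists2 a : 'I_3 -> k, \sum_(i < 3) a i = 0 & forall i, v i ^+ n = a i ^+ N)
          (dual_eq.@[v] == 0).
Proof.
rewrite meval_dual_eq; apply: (iffP (bh_eq0P q_gt1 q_char _ _ _)) => [[a [b [ha hb hc]]]|[a]].
  exists (fun i => if i == i0 then a else if i == i1 then b else - (a + b)).
    by rewrite sum3E /= subrr.
  by apply: forall_ord3; rewrite //= exprqSN.
rewrite sum3E => /eqP; rewrite addr_eq0 => /eqP ab h; exists (a i0), (a i1).
by rewrite ab exprqSN // !h.
Qed.

Lemma on_curve_BH Q :
  preimage (gamma n) (ballico_hefez (k := k) q) Q <-> on_curve dual_eq Q.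
Proof.
have line0E v : (line0 k).@[fun i => v 0 i] = \sum_(i < 3) v 0 i.
  by rewrite /line0 raddf_sum; apply: eq_bigr => i _; rewrite /= mevalXU.
split=> [[R]|/eqP/dual_eqP[a a_sum aQ]].
  rewrite /on_curve line0E => R_line /eqP/point_eqP[c hc].
  apply/eqP/dual_eqP; exists (fun i => nroot N c * coords R 0 i).
    by rewrite -mulr_sumr R_line mulr0.
  by move=> i; rewrite exprMn nrootK //; move/rowP/(_ i): hc; rewrite !mxE.
have a0 : \row_i a i != 0.
  have /rV0Pn[i nzi] := coords_neq0 Q; apply/rV0Pn; exists i.
  rewrite mxE; apply: contraNneq nzi => ai0.
  by have /eqP := aQ i; rewrite ai0 expr0n expf_eq0 => /andP[].
have [c c0 hc] := coords_point a0.
exists (point a0).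
  rewrite /on_curve line0E; transitivity (c * \sum_(i < 3) a i).
    by rewrite mulr_sumr; apply: eq_bigr => i _; rewrite !(mxE, hc).
  by rewrite a_sum mulr0.
apply/eqP/point_eqP; exists (c ^+ N)^-1; apply/rowP => i.
by rewrite !mxE hc !mxE exprMn mulKf ?expf_neq0.
Qed.

Lemma n_pred : n.-1 = (q * N)%N. Proof. by rewrite addn1 mulnS addnC -mulnn. Qed.

Lemma gradient_fermat P : gradient (fermat k n) P = \row_i coords P 0 i ^+ n.-1.
Proof.
apply/rowP => i; rewrite !mxE /fermat (linear_sum (mderiv i)) raddf_sum /= (bigD1 i) //= big1 => [|j ji].
  by rewrite addr0 mderiv_Xn eqxx mul1n natn1 // scale1r rmorphXn /= mevalXU.
by rewrite mderiv_Xn (negPf ji) scale0r meval0.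
Qed.

Lemma meval_fermat (v : 'I_3 -> k) : (fermat k n).@[v] = \sum_(i < 3) v i ^+ n.
Proof. by rewrite /fermat raddf_sum; apply: eq_bigr => i _; rewrite /= rmorphXn /= mevalXU. Qed.

(** Given w with w_i^n = a_i^N and s_i^q = a_i, the point with coordinates
    x_i = s_i / w_i satisfies x_i^n = s_i and x_i^(n-1) = w_i, because
    w_i^n = s_i^(n-1).  Hence it lies on the Fermat curve and is mapped to w. *)
Lemma on_curve_dual Q : dual_curve (fermat k n) Q <-> on_curve dual_eq Q.
Proof.
split=> [[P]|/eqP/dual_eqP[a a_sum aQ]].
  rewrite /on_curve meval_fermat => hP [g0 ->]; have [c c0 ->] := coords_point g0.
  apply/eqP/dual_eqP.
  exists (fun i => nroot N (c ^+ n) * (coords P 0 i ^+ n) ^+ q).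
    rewrite -mulr_sumr -[X in _ * X = _](_ : (\sum_(i < 3) coords P 0 i ^+ n) ^+ q = _).
      by rewrite hP expr0n eqn0Ngt (ltnW q_gt1) mulr0.
    by rewrite !sum3E !(exprqD q_char).
  move=> i; rewrite gradient_fermat !mxE !exprMn nrootK // n_pred -!exprM.
  by congr (_ * _ ^+ _); rewrite [LHS]mulnC mulnA.
pose s i := nroot q (a i); have q_gt0 := ltnW q_gt1.
have sK i : s i ^+ q = a i by rewrite nrootK.
have s_sum : \sum_(i < 3) s i = 0.
  apply/eqP; have : (\sum_(i < 3) s i) ^+ q == 0.
    by rewrite !sum3E !exprqD // !sK -a_sum sum3E.
  by rewrite expf_eq0 q_gt0.
pose x i := s i / coords Q 0 i.
have s0 i : coords Q 0 i = 0 -> s i = 0.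
  move=> Qi; apply/eqP; have := aQ i; rewrite Qi expr0n addn1 /= => /esym/eqP.
  by rewrite expf_eq0 /= -sK expf_eq0 => /andP[].
have QsN i : coords Q 0 i ^+ n = s i ^+ n.-1 by rewrite n_pred exprM sK.
have xn i : x i ^+ n = s i.
  have [Qi|Qi] := eqVneq (coords Q 0 i) 0.
    by rewrite /x s0 // mul0r expr0n addn1.
  have si : s i != 0.
    apply: contraNneq Qi => si; have /eqP := QsN i.
    by rewrite si n_pred expr0n eqn0Ngt muln_gt0 q_gt0 expf_eq0 => /andP[].
  rewrite {1}/x expr_div_n QsN.
  have -> : s i ^+ n = s i * s i ^+ n.-1 by rewrite -exprS prednK ?n_gt0.
  rewrite mulfK //.
  by rewrite expf_neq0.
have xQ i : x i ^+ n.-1 = coords Q 0 i.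
  have [Qi|Qi] := eqVneq (coords Q 0 i) 0.
    by rewrite /x s0 // mul0r Qi expr0n n_pred eqn0Ngt muln_gt0 q_gt0.
  have si : s i != 0.
    apply: contraNneq Qi => si; have /eqP := QsN i.
    by rewrite si n_pred expr0n eqn0Ngt muln_gt0 q_gt0 expf_eq0 => /andP[].
  have xi : x i != 0 by rewrite mulf_neq0 ?invr_neq0.
  apply: (mulIf xi); rewrite -exprSr prednK ?n_gt0 // xn.
  by rewrite /x mulrC divfK.
have x0 : \row_i x i != 0.
  have /rV0Pn[i nzi] := coords_neq0 Q; apply/rV0Pn; exists i; rewrite mxE.
  by apply: contraNneq nzi => xi; rewrite -xQ xi n_pred expr0n eqn0Ngt muln_gt0 q_gt0.
have [c c0 hc] := coords_point x0.
have hg : gradient (fermat k n) (point x0) = c ^+ n.-1 *: coords Q.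
  by rewrite gradient_fermat; apply/rowP => i; rewrite !(mxE, hc) exprMn xQ.
have g0 : gradient (fermat k n) (point x0) != 0.
  by rewrite hg scaler_eq0 negb_or expf_neq0 // coords_neq0.
exists (point x0).
  rewrite /on_curve meval_fermat; transitivity (c ^+ n * \sum_(i < 3) s i).
    by rewrite mulr_sumr; apply: eq_bigr => i _; rewrite !(mxE, hc) exprMn xn.
  by rewrite s_sum mulr0.
exists g0; rewrite -[LHS]point_coords; apply/eqP/point_eqP.
exists (c ^+ n.-1)^-1; rewrite hg scalerA mulVf ?scale1r //.
by rewrite expf_neq0.
Qed.

End DualCurve.

(** * Polynomials as functions *)

Section Vanishing.

Lemma closed_poly_eq0 (k : closedFieldType) (r : {poly k}) :
  (forall x, r.[x] = 0) -> r = 0.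
Proof.
move=> r0; apply/eqP/negPn/negP => nz_r.
have /closed_rootP[x] : size (r * 'X + 1) != 1%N.
  by rewrite -polyC1 size_MXaddC (negPf nz_r) /= eqSS size_poly_eq0.
by rewrite rootE !hornerE r0 mul0r add0r oner_eq0.
Qed.

Section Muni.
Variables (k : comNzRingType) (m : nat).
Implicit Types (p : {mpoly k[m.+1]}) (v : 'I_m.+1 -> k).

Definition of_muni (r : {poly {mpoly k[m]}}) : {mpoly k[m.+1]} :=
  (map_poly (@mwiden m k) r).['X_ord_max].

Lemma of_muniM r s : of_muni (r * s) = of_muni r * of_muni s.
Proof. by rewrite /of_muni rmorphM hornerM. Qed.

Lemma muniK : cancel (@muni m k) of_muni.
Proof.
move=> p; rewrite muniE /of_muni raddf_sum /= horner_sum [RHS]mpolyE.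
apply: eq_bigr => mm _; rewrite -!mul_polyC -mul_mpolyC !rmorphM /= !map_polyC /=.
rewrite map_polyXn !hornerE /= mwidenC mwidenX -mulrA mul_mpolyC; congr (_ *: _).
rewrite mpolyXn -mpolyXD; congr 'X_[_]; apply/mnmP => i.
rewrite mnmDE mulmnE mnm1E; have [j ->|->] := unliftP ord_max i.
  rewrite (_ : lift ord_max j = widen_ord (leqnSn _) j); last exact/val_inj/lift_max.
  rewrite mnmwiden_widen mnmE (_ : (_ == _) = false) ?addn0 //.
  by apply/eqP => /(congr1 val) /= E; have := ltn_ord j; rewrite -E ltnn.
by rewrite mnmwiden_ordmax eqxx mul1n.
Qed.

Lemma meval_muni p v :
  p.@[v] = (map_poly (meval (fun i => v (widen_ord (leqnSn m) i))) (muni p)).[v ord_max].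
Proof.
rewrite muniE raddf_sum /= horner_sum mevalE.
apply: eq_bigr => mm _; rewrite -!mul_polyC -mul_mpolyC !rmorphM /= !map_polyC /=.
rewrite map_polyXn !hornerE /= mevalC mevalX -mulrA big_ord_recr /=; congr (_ * (_ * _)).
by apply: eq_bigr => i _; rewrite mnmE.
Qed.

End Muni.

Lemma mpoly_eval_eq0 (k : closedFieldType) m (p : {mpoly k[m]}) :
  (forall v, p.@[v] = 0) -> p = 0.
Proof.
elim: m p => [p p0|m IH p p0].
  apply/mpolyP => mm; rewrite mcoeff0 -(p0 (fun=> 0)) (_ : p = (p@_mm)%:MP).
    by rewrite mevalC mcoeffC (_ : mm = 0%MM) ?eqxx ?mulr1 //; apply/mnmP => -[].
  apply/mpolyP => mm'; rewrite mcoeffC (_ : mm' = mm); last by apply/mnmP => -[].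
  by rewrite (_ : mm = 0%MM) ?eqxx ?mulr1 //; apply/mnmP => -[].
(* All coefficients of p in the last variable vanish as functions. *)
rewrite -[p]muniK (_ : muni p = 0) ?/of_muni ?raddf0 ?horner0 //.
apply/polyP => i; rewrite coef0; apply: IH => v.
suff /polyP/(_ i) : map_poly (meval v) (muni p) = 0 by rewrite coef_map coef0.
apply: closed_poly_eq0 => x.
pose v' (j : 'I_m.+1) := if unlift ord_max j is Some j' then v j' else x.
have := p0 v'; rewrite meval_muni {2}/v' unlift_none => <-; congr (_.[x]).
apply: eq_map_poly => r; apply: meval_eq => j; rewrite /v'.
by rewrite (_ : widen_ord _ j = lift ord_max j) ?liftK //; apply/esym/val_inj/lift_max.
Qed.

Lemma mpoly_eval_inj (k : closedFieldType) m (p r : {mpoly k[m]}) :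
  (forall v, p.@[v] = r.@[v]) -> p = r.
Proof.
move=> h; apply/eqP; rewrite -subr_eq0; apply/eqP/mpoly_eval_eq0 => v.
by rewrite mevalB h subrr.
Qed.

End Vanishing.

(** * The equation generates the ideal of the dual curve *)
Lemma muniXU (k : comNzRingType) m (i : 'I_m.+1) :
  muni ('X_i : {mpoly k[m.+1]}) = if unlift ord_max i is Some j then ('X_j)%:P else 'X.
Proof.
rewrite muniE msuppX big_seq1 mcoeffX eqxx scale1r mnm1E.
have [j ->|->] := unliftP ord_max i.
  rewrite (_ : (_ == _) = false); last first.
    apply/eqP => /(congr1 (@nat_of_ord _)); rewrite lift_max => /= E.
    by have := ltn_ord j; rewrite E ltnn.
  rewrite expr0 alg_polyC; congr (_%:P); congr 'X_[_]; apply/mnmP => l.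
  by rewrite mnmE !mnm1E -!(inj_eq (@ord_inj _)) lift_max.
rewrite eqxx expr1 (_ : [multinom _ | _ < _] = 0%MM) ?mpolyX0 ?scale1r //.
by apply/mnmP => l; rewrite mnmE mnm1E mnm0E -val_eqE /= eq_sym ltn_eqF.
Qed.

Lemma dhomog_evalZ (k : comNzRingType) m d (G : {mpoly k[m]}) c v :
  G \is d.-homog -> G.@[fun i => c * v i] = c ^+ d * G.@[v].
Proof.
move=> /dhomogP hG; rewrite !mevalE mulr_sumr; apply: eq_big_seq => mm /hG <-.
rewrite mulrCA; congr (_ * _); rewrite /= mdegE -prodrXr -big_split /=.
by apply: eq_bigr => i _; rewrite exprMn.
Qed.

Section MonicDickson.
Variables (R : idomainType) (W : {poly R}) (c : R) (d : nat).
Hypotheses (d_gt0 : (0 < d)%N) (W_monic : W \is monic) (W_size : size W = d.+1).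

Lemma dickson_monic m :
  dickson W c%:P m.+1 \is monic /\ size (dickson W c%:P m.+1) = (d * m.+1).+1.
Proof.
have step m' : dickson W c%:P m'.+1 \is monic ->
    size (dickson W c%:P m'.+1) = (d * m'.+1).+1 ->
    (size (dickson W c%:P m') <= (d * m').+1)%N ->
    dickson W c%:P m'.+2 \is monic /\ size (dickson W c%:P m'.+2) = (d * m'.+2).+1.
  move=> M1 S1 S0; set D1 := dickson _ _ m'.+1 in M1 S1 *.
  have S2 : size (W * D1) = (d * m'.+2).+1.
    by rewrite size_monicM ?monic_neq0 // W_size S1 mulnS addSn addnS mulnS; lia.
  have lt : (size (- (c%:P * dickson W c%:P m')) < size (W * D1)%R)%N.
    rewrite size_polyN S2 mul_polyC (leq_ltn_trans (size_scale_leq _ _)) //.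
    by rewrite (leq_ltn_trans S0) // ltnS ltn_pmul2l.
  by rewrite dicksonSS -/D1 monicE lead_coefDl // size_polyDl // -monicE monicMl.
elim/nat_ind2: m => [||m [_ Sm] [Mm1 Sm1]]; first by rewrite muln1.
  by apply: step; rewrite ?muln1 //= muln0 -polyC_natr size_polyC_leq1.
by apply: step => //; rewrite Sm.
Qed.
End MonicDickson.

Lemma bh_monic (R : idomainType) (a b : R) d q : (0 < d)%N ->
  bh q a%:P b%:P 'X^d \is monic /\ size (bh q a%:P b%:P 'X^d) = (d * q.+1).+1.
Proof.
move=> d_gt0; pose W : {poly R} := 'X^d - (a + b)%:P; pose e := a ^+ q * b + a * b ^+ q.
have -> : bh q a%:P b%:P 'X^d = dickson W (a * b)%:P q.+1 + (- e)%:P.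
  rewrite /bh (_ : 'X^d - a%:P - b%:P = W); last by rewrite /W polyCD opprD addrA.
  by rewrite /e !(polyCN, polyCD, polyCM, polyC_exp) opprD addrA.
have [M S] := @dickson_monic _ W (a * b) d d_gt0 (monicXnsubC _ d_gt0) (size_XnsubC _ d_gt0) q.
have lt : (size (- e)%:P < size (dickson W (a * b)%:P q.+1))%N.
  by rewrite S (leq_ltn_trans (size_polyC_leq1 _)) // ltnS muln_gt0 d_gt0.
by rewrite monicE lead_coefDl // size_polyDl.
Qed.

Lemma dhomogB (k : comNzRingType) m d (p r : {mpoly k[m]}) :
  p \is d.-homog -> r \is d.-homog -> p - r \is d.-homog.
Proof. by move=> hp hr; rewrite dhomogD // dhomogN. Qed.

Section Reduced.
Variables (k : closedFieldType) (q : nat).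
Hypotheses (q_gt1 : (1 < q)%N) (q_char : [pchar k].-nat q).

Local Notation N := q.+1.
Local Notation n := (q ^ 2 + q + 1)%N.
Local Notation F := (dual_eq k q).

Lemma muni_dual_eq :
  muni F \is monic /\ size (muni F) = (n * N).+1.
Proof.
have -> : muni F = bh q ('X_0 ^+ n)%:P ('X_1 ^+ n)%:P ('X ^+ n).
  have e0 : i0 = lift ord_max (0 : 'I_2) by apply: val_inj.
  have e1 : i1 = lift ord_max (1 : 'I_2) by apply: val_inj.
  have e2 : i2 = ord_max by apply: val_inj.
  rewrite /dual_eq rmorph_bh /= !rmorphXn /= !muniXU.
  by rewrite e0 e1 e2 !liftK unlift_none.
exact: bh_monic (n_gt0 q).
Qed.

Lemma dhomog_dual_eq : F \is (n * N).-homog.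
Proof.
have hX i : ('X_i ^+ n : {mpoly k[3]}) \is n.-homog.
  by rewrite -[n in X in _ \is X]mul1n dhomogMn // dhomogX; apply/eqP/mdeg1.
have hD m : dickson ('X_i2 ^+ n - 'X_i0 ^+ n - 'X_i1 ^+ n : {mpoly k[3]})
    ('X_i0 ^+ n * 'X_i1 ^+ n) m \is (n * m).-homog.
  elim/nat_ind2: m => [||m IH0 IH1].
  - by rewrite muln0 /= -mpolyC_nat; apply/dhomogP => mm; rewrite msuppC;
      case: ifP => // _; rewrite inE => /eqP->; apply: mdeg0.
  - by rewrite muln1 /= !dhomogB.
  rewrite dicksonSS; apply: dhomogB.
    by rewrite [in X in _ \is X]mulnS dhomogM // !dhomogB.
  by rewrite !mulnS addnA dhomogM // dhomogM.
rewrite /dual_eq /bh.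
have hXq i := dhomogMn q (hX i); apply: dhomogB; first apply: dhomogB.
- exact: hD.
- by rewrite mulnS [(n + n * q)%N]addnC dhomogM.
by rewrite mulnS dhomogM.
Qed.

(** The values (a + z b)^N are pairwise distinct and nonzero unless
    (a^N)^(q-1) = (b^N)^(q-1), and each of them has n distinct n-th roots. *)
Lemma generic_fiber (x y : k) : x != 0 -> y != 0 ->
    x ^+ (n * q.-1) != y ^+ (n * q.-1) ->
  exists rs : seq k, [/\ uniq rs, size rs = (n * N)%N &
    forall z, z \in rs -> bh q (x ^+ n) (y ^+ n) (z ^+ n) = 0].
Proof.
move=> x0 y0 xy; pose a := nroot N (x ^+ n); pose b := nroot N (y ^+ n).
have aN : a ^+ N = x ^+ n by rewrite nrootK.
have bN : b ^+ N = y ^+ n by rewrite nrootK.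
have a0 : a != 0 by have := expf_neq0 n x0; rewrite -aN expf_eq0.
have b0 : b != 0 by have := expf_neq0 n y0; rewrite -bN expf_eq0.
have ab0 z : z \in nroots N 1 -> a + z * b != 0.
  rewrite mem_nroots // => zN; apply: contra_neqN xy => /eqP.
  move/eqP; rewrite addr_eq0 => /eqP ab; rewrite !exprM -aN -bN ab.
  by rewrite exprqSN // exprMn (eqP zN) mul1r.
have inj z z' : z \in nroots N 1 -> z' \in nroots N 1 ->
    (a + z * b) ^+ N = (a + z' * b) ^+ N -> z = z'.
  move=> zN zN'; rewrite !exprN_add_unity // => /eqP.
  have z0 := unity_neq0 (ltn0Sn _) zN; have z0' := unity_neq0 (ltn0Sn _) zN'.
  set al := a ^+ q * b; set be := a * b ^+ q.
  rewrite -subr_eq0 [X in X == 0](_ : _ = (z - z') * (al - (z * z')^-1 * be)); last first.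
    by field; rewrite z0 z0'.
  rewrite mulf_eq0 !subr_eq0 => /orP[/eqP//|/eqP/(congr1 (fun t => t ^+ N))].
  have zz1 : (z * z')^-1 ^+ N = 1.
    by move: zN zN'; rewrite !mem_nroots // exprVn exprMn => /eqP-> /eqP->; rewrite mulr1 invr1.
  rewrite [(_^-1 * be) ^+ N]exprMn zz1 mul1r => E.
  case/eqP: xy; rewrite !exprM -aN -bN; move: E; rewrite /al /be !exprMn.
  rewrite ![_ ^+ q ^+ N]exprAC.
  have a0N := expf_neq0 N a0; have b0N := expf_neq0 N b0.
  move: (a ^+ N) (b ^+ N) a0N b0N => A B A0 B0; rewrite -(prednK (ltnW q_gt1)) !exprS /= => E.
  by apply: (mulfI A0); apply: (mulIf B0); rewrite E mulrAC mulrA.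
pose rs := [seq nroot n ((a + z * b) ^+ N) * t | z <- nroots N 1, t <- nroots n 1].
have rsn z t : t \in nroots n 1 -> (nroot n ((a + z * b) ^+ N) * t) ^+ n = (a + z * b) ^+ N.
  by rewrite mem_nroots ?n_gt0 // exprMn nrootK ?n_gt0 // => /eqP->; rewrite mulr1.
exists rs; split; last first.
- move=> z /allpairsP[[z1 t] /= [z1N tn ->]]; rewrite rsn // -aN -bN.
  apply/eqP/(bh_eq0P q_gt1 q_char); exists a, (z1 * b); split=> //.
  by move: z1N; rewrite mem_nroots // exprMn => /eqP->; rewrite mul1r.
- by rewrite size_allpairs !size_nroots ?n_gt0 // mulnC.
apply: allpairs_uniq.
- by rewrite uniq_nroots ?oner_neq0 // natN_neq0.
- by rewrite uniq_nroots ?n_gt0 ?oner_neq0 // natn_neq0.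
move=> _ _ /allpairsP[[z t] /= [zN tn ->]] /allpairsP[[z' t'] /= [zN' tn' ->]] /= E.
have zz' : z = z' by apply: inj => //; rewrite -(rsn z t) // -(rsn z' t') // E.
move: E; rewrite zz' => /mulfI -> //.
by have := expf_neq0 N (ab0 _ zN'); rewrite -{1}[_ ^+ N](nrootK (n_gt0 q)) expf_eq0 n_gt0.
Qed.

(** The remainder of G modulo F, of degree less than n N in x_2, vanishes at the
    n N points of each general fibre; so its coefficients vanish on a nonempty
    open set. *)
Lemma dual_eq_generates d (G : {mpoly k[3]}) : G \is d.-homog ->
  (forall P, on_curve F P -> on_curve G P) -> exists H, G = H * F.
Proof.
move=> G_hom G0; have [FM FS] := muni_dual_eq.
have G_eval v : v i0 != 0 -> F.@[v] = 0 -> G.@[v] = 0.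
  move=> v0 Fv; have w0 : \row_i v i != 0 by apply/rV0Pn; exists i0; rewrite mxE.
  have [c c0 hc] := coords_point w0; have := G0 (point w0).
  have cv i : coords (point w0) 0 i = c * v i by rewrite hc !mxE.
  rewrite /on_curve !(meval_eq _ cv) (dhomog_evalZ _ _ G_hom) (dhomog_evalZ _ _ dhomog_dual_eq).
  rewrite Fv mulr0 => /(_ erefl)/eqP; rewrite mulf_eq0 expf_eq0 (negPf c0) andbF /=.
  by move/eqP.
have Geq := Pdiv.IdomainMonic.divp_eq FM (muni G).
set Q := (_ %/ _)%R in Geq; set r := (_ %% _)%R in Geq.
have r_size : (size r <= n * N)%N by rewrite -ltnS -FS ltn_modp monic_neq0.
suff r0 : r = 0.
  by exists (of_muni Q); rewrite -[LHS]muniK Geq r0 addr0 of_muniM muniK.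
(* Where dl is nonzero, [generic_fiber] applies. *)
pose dl : {mpoly k[2]} := 'X_0 * 'X_1 * ('X_0 ^+ (n * q.-1) - 'X_1 ^+ (n * q.-1)).
have dl0 : dl != 0.
  apply/eqP => dl0; have m_gt0 : (0 < n * q.-1)%N by rewrite muln_gt0 n_gt0 -ltnS (ltn_predK q_gt1).
  have : 'X * ('X^(n * q.-1) - 1%:P) = 0 :> {poly k}.
    apply: closed_poly_eq0 => y; have := meval0 (fun i : 'I_2 => if i == 0 then 1 else y).
    rewrite -dl0 !mevalM mevalB !rmorphXn /= !mevalXU /= mul1r expr1n => /eqP h.
    by apply/eqP; move: h; rewrite !hornerE /= -opprB mulrN oppr_eq0.
  by apply/eqP; rewrite mulf_neq0 ?polyX_eq0 ?monic_neq0 ?monicXnsubC.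
apply/polyP => i; rewrite coef0; apply/eqP.
suff : r`_i * dl = 0 by move/eqP; rewrite mulf_eq0 (negPf dl0) orbF.
apply: mpoly_eval_eq0 => v; rewrite mevalM; apply/eqP; rewrite mulf_eq0.
have [//|dlv] := eqVneq dl.@[v] 0; first by rewrite orbT.
rewrite orbF; move: dlv.
rewrite /dl !mevalM mevalB !rmorphXn /= !mevalXU !mulf_eq0 !negb_or subr_eq0 => /andP[/andP[x0 y0] xy].
have [rs [rs_uniq rs_size rs0]] := generic_fiber x0 y0 xy.
suff /polyP/(_ i) : map_poly (meval v) r = 0 by rewrite coef_map coef0 => ->.
apply/eqP/negPn/negP => rv0.
have : (size rs < size (map_poly (meval v) r))%N.
  apply: max_poly_roots => //; apply/allP => z /rs0 zF.
  pose w (j : 'I_3) := if unlift ord_max j is Some j' then v j' else z.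
  have w_lift j : w (widen_ord (leqnSn 2) j) = v j.
    by rewrite /w (_ : widen_ord _ j = lift ord_max j) ?liftK //; apply/esym/val_inj/lift_max.
  have w0 : w i0 = v 0 by rewrite -w_lift; congr w; apply: val_inj.
  have w1 : w i1 = v 1 by rewrite -w_lift; congr w; apply: val_inj.
  have wm : w ord_max = z by rewrite /w unlift_none.
  have w2 : w i2 = z by rewrite -wm; congr w; apply: val_inj.
  have Fw : F.@[w] = 0 by rewrite meval_dual_eq w0 w1 w2.
  have := G_eval w; rewrite w0 => /(_ x0 Fw).
  have mE p : p.@[w] = (map_poly (meval v) (muni p)).[z].
    rewrite meval_muni wm; congr (_.[_]); apply: eq_map_poly => s.
    exact/meval_eq/w_lift.
  rewrite mE Geq rmorphD rmorphM /= hornerD hornerM -mE Fw mulr0 add0r.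
  by rewrite rootE => ->.
rewrite rs_size; apply/negP; rewrite -leqNgt (leq_trans _ r_size) //.
exact: size_poly.
Qed.

End Reduced.

(** * Order of vanishing at the origin *)

Section Order.
Variables (k : comNzRingType) (m : nat).
Implicit Types f g : {mpoly k[m]}.

(** [f] lies in the [d]-th power of the ideal of the origin. *)
Definition ord_ge (d : nat) f := forall mm, (mdeg mm < d)%N -> f@_mm = 0.

Lemma ord_ge_zero d : ord_ge d 0. Proof. by move=> mm _; rewrite mcoeff0. Qed.

Lemma ord_geW d d' f : (d' <= d)%N -> ord_ge d f -> ord_ge d' f.
Proof. by move=> dd h mm lt; apply: h; apply: leq_trans dd. Qed.

Lemma ord_geD d f g : ord_ge d f -> ord_ge d g -> ord_ge d (f + g).
Proof. by move=> hf hg mm lt; rewrite mcoeffD hf ?hg ?addr0. Qed.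

Lemma ord_geN d f : ord_ge d f -> ord_ge d (- f).
Proof. by move=> hf mm lt; rewrite mcoeffN hf ?oppr0. Qed.

Lemma ord_geM d d' f g : ord_ge d f -> ord_ge d' g -> ord_ge (d + d') (f * g).
Proof.
move=> hf hg mm lt; rewrite mcoeffM big1 // => -[a b] /= /eqP E.
have [lta|lea] := ltnP (mdeg a) d; first by rewrite hf ?mul0r.
rewrite hg ?mulr0 // -(ltn_add2l d); apply: leq_ltn_trans lt.
have -> : forall x, (x <= mdeg mm)%N = (x <= mdeg (a + b)%MM)%N by move=> x; rewrite -E.
by rewrite mdegD leq_add2r.
Qed.

Lemma ord_geMr d f g : ord_ge d f -> ord_ge d (f * g).
Proof. by move=> hf; rewrite -[d]addn0; apply: ord_geM. Qed.

Lemma ord_geZ d c f : ord_ge d f -> ord_ge d (c *: f).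
Proof. by move=> hf mm lt; rewrite mcoeffZ hf ?mulr0. Qed.

Lemma ord_geX d f e : ord_ge d f -> ord_ge (e * d) (f ^+ e).
Proof.
by move=> hf; elim: e => [|e IH]; rewrite ?mul0n // mulSn exprS; apply: ord_geM.
Qed.

Lemma ord_ge_var i : ord_ge 1 ('X_i : {mpoly k[m]}).
Proof.
move=> mm; rewrite ltnS leqn0 mdeg_eq0 => /eqP->; rewrite mcoeffX.
by rewrite mnm1_eq0.
Qed.

Lemma ord_ge_const f : ord_ge 1 (f - (f@_0)%:MP).
Proof.
move=> mm; rewrite ltnS leqn0 mdeg_eq0 => /eqP->.
by rewrite mcoeffB mcoeffC eqxx mulr1 subrr.
Qed.

Lemma ord_ge_cong d : ring_congruence (fun f g => ord_ge d (f - g)).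
Proof.
split=> [x|x x' y y' hx hy|x x' y y' hx hy].
- by rewrite subrr; apply: ord_ge_zero.
- rewrite (_ : _ - _ = (x - x') - (y - y')); last by ring.
  exact: ord_geD (ord_geN hy).
rewrite (_ : _ - _ = (x - x') * y + (y - y') * x'); last by ring.
by apply: ord_geD; apply: ord_geMr.
Qed.

Lemma mul_const0 (f g : {mpoly k[m]}) : (f * g)@_0 = f@_0 * g@_0.
Proof. exact: (rmorphM (mcoeff 0%MM)). Qed.

End Order.

(** * Singular points off the coordinate axes *)

Section Torus.
Variables (k : closedFieldType) (q : nat).
Hypotheses (q_gt1 : (1 < q)%N) (q_char : [pchar k].-nat q).

Local Notation N := q.+1.
Local Notation n := (q ^ 2 + q + 1)%N.
Local Notation F := (dual_eq k q).

Definition unity_pairs : seq (k * k) :=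
  [seq (z, e) | z <- nroots N (1 : k), e <- nroots N (1 : k)].

Lemma mem_unity_pairs z e :
  ((z, e) \in unity_pairs) = (z ^+ N == 1) && (e ^+ N == 1).
Proof.
rewrite -!mem_nroots //; apply/allpairsP/andP => [[[x y] /= [? ? [-> ->]]]//|[hz he]].
by exists (z, e).
Qed.

Lemma uniq_unity_pairs : uniq unity_pairs.
Proof.
have u := uniq_nroots (ltn0Sn q) (natN_neq0 q_gt1 q_char) (oner_neq0 k).
by apply: allpairs_uniq => // -[? ?] [? ?].
Qed.

Definition line_factor m (A B C : {mpoly k[m]}) (x : k * k) : {mpoly k[m]} :=
  C - x.2%:MP * (A + x.1%:MP * B).

Lemma bh_lines m (A B C : {mpoly k[m]}) :
  bh q (A ^+ N) (B ^+ N) (C ^+ N) = \prod_(x <- unity_pairs) line_factor A B C x.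
Proof.
apply: mpoly_eval_inj => v.
rewrite rmorph_bh /= !rmorphXn /= (bh_prod q_gt1 q_char) rmorph_prod /= big_allpairs_dep /=.
apply: eq_bigr => z _; rewrite -(prod_unity (ltn0Sn q)); apply: eq_bigr => e _.
by rewrite /line_factor mevalB !mevalM mevalD mevalM !mevalC.
Qed.

(** If the line of index (z, e) passes through (a, b, a + b), taking N-th powers
    in a + b = e (a + z b) removes e and leaves
    (z - 1) (a b^q - z a^q b) = 0.  By the three inequalities the two linear
    forms stay independent when any one of the coordinates is set to 0, so the
    branches are transversal in every chart. *)
Lemma second_line (a b : k) : a != 0 -> b != 0 -> a + b != 0 ->
  forall z e, (z, e) \in unity_pairs -> (z, e) != (1, 1) -> a + b = e * (a + z * b) ->
  [/\ b ^+ q = z * (b * a ^+ q.-1), z != 1, e != 1 & e * z != 1].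
Proof.
move=> a0 b0 ab0 z e; rewrite mem_unity_pairs => /andP[zN eN] ne11 E.
have z1 : z != 1.
  apply: contraNneq ne11 => z1; rewrite z1 xpair_eqE eqxx /=.
  by move: E; rewrite z1 mul1r -[LHS]mul1r => /(mulIf ab0) <-.
have zM : z \in nroots N 1 by rewrite mem_nroots.
have z0 := unity_neq0 (ltn0Sn _) zM.
split=> //; last 2 first.
- apply: contraNneq z1 => e1; move: E; rewrite e1 mul1r => /addrI.
  by rewrite -[LHS]mul1r => /(mulIf b0) <-.
- apply: contraNneq z1 => ez; move: E; rewrite mulrDr mulrA ez mul1r => /addIr.
  by rewrite -[LHS]mul1r => /(mulIf a0) e1; rewrite -ez -e1 mul1r.
have := congr1 (fun t => t ^+ N) E; rewrite exprMn (eqP eN) mul1r.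
have h1 : (1 : k) \in nroots N 1 by rewrite mem_nroots // expr1n.
rewrite -[b in (a + b) ^+ N]mul1r !exprN_add_unity // invr1 !mul1r => /eqP.
rewrite -subr_eq0 [X in X == 0](_ : _ = z^-1 * (z - 1) * (a * b ^+ q - z * (a ^+ q * b))); last first.
  by field.
rewrite !mulf_eq0 invr_eq0 (negPf z0) subr_eq0 (negPf z1) /= subr_eq0 => /eqP h.
apply: (mulfI a0); rewrite h -{1}(prednK (ltnW q_gt1)) exprS.
by ring.
Qed.

Definition grad_cong m (v : 'I_m -> k) (f g : {mpoly k[m]}) :=
  f.@[v] = g.@[v] /\ forall i, (f^`M(i)).@[v] = (g^`M(i)).@[v].

Lemma grad_congP m (v : 'I_m -> k) : ring_congruence (grad_cong v).
Proof.
split=> // x x' y y' [ex dx] [ey dy]; split.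
- by rewrite !mevalB ex ey.
- by move=> i; rewrite !mderivB !mevalB dx dy.
- by rewrite !mevalM ex ey.
by move=> i; rewrite !mderivM !mevalD !mevalM ex ey dx dy.
Qed.

(** If one factor of a product vanishes to first order at v, the gradient of the
    product at v is the gradient of that factor times the value of the others. *)
Lemma grad_prod_eq0 m (v : 'I_m -> k) (T : eqType) (s : seq T) (L : T -> {mpoly k[m]}) x j :
    uniq s -> x \in s -> (L x).@[v] = 0 -> ((L x)^`M(j)).@[v] != 0 ->
  (forall i, ((\prod_(y <- s) L y)^`M(i)).@[v] = 0) <->
  exists y, [/\ y \in s, y != x & (L y).@[v] = 0].
Proof.
move=> us xs Lx dLx; rewrite (bigD1_seq x) //=; set R := \prod_(_ <- _ | _) _.
have dE i : ((L x * R)^`M(i)).@[v] = ((L x)^`M(i)).@[v] * R.@[v].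
  by rewrite mderivM mevalD !mevalM Lx mul0r addr0.
have R0 : (R.@[v] == 0) <-> exists y, [/\ y \in s, y != x & (L y).@[v] = 0].
  rewrite /R rmorph_prod /= prodf_seq_eq0; split.
    by case/hasP => y ys /andP[yx /eqP Ly]; exists y.
  by case=> y [ys yx Ly]; apply/hasP; exists y => //; rewrite yx Ly eqxx.
split=> [/(_ j)/eqP|/R0/eqP Rv i]; last by rewrite dE Rv mulr0.
by rewrite dE mulf_eq0 (negPf dLx) => /R0.
Qed.

(** The point (a, b, a + b) lies above the n-th powers of w, and a line of
    index (z, e) contains it besides the line c = a + b, of index (1, 1). *)
Definition on_two_lines (w : 'I_3 -> k) (a b z e : k) :=
  [/\ [/\ a ^+ N = w i0 ^+ n, b ^+ N = w i1 ^+ n & (a + b) ^+ N = w i2 ^+ n],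
      (z, e) \in unity_pairs, (z, e) != (1, 1) & a + b = e * (a + z * b)].

Lemma torus_coord (x w : k) : w != 0 -> x ^+ N = w ^+ n -> x != 0.
Proof. by move=> w0 E; have := expf_neq0 n w0; rewrite -E expf_eq0. Qed.

(** A coordinate multiplied by x / w has N-th power w^(q^2) times its own, which
    agrees with its n-th power to order q^2 at w. *)
Lemma torus_rho (x w : k) : w != 0 -> x ^+ N = w ^+ n -> (x / w) ^+ N = w ^+ (q ^ 2).
Proof.
move=> w0 E; rewrite expr_div_n E -addnA addn1 exprD mulfK //.
by rewrite expf_neq0.
Qed.

(** At w, each x_i^n has the same value and derivatives as the N-th power of the
    rescaled coordinate, so F may be replaced by the product of lines. *)
Lemma torus_gradient (w : 'I_3 -> k) a b : (forall i, w i != 0) ->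
    a ^+ N = w i0 ^+ n -> b ^+ N = w i1 ^+ n -> (a + b) ^+ N = w i2 ^+ n ->
  (forall i, (F^`M(i)).@[w] = 0) <-> exists z e, on_two_lines w a b z e.
Proof.
move=> w0 ha hb hc.
pose r0 := a / w i0; pose r1 := b / w i1; pose r2 := (a + b) / w i2.
have aw : r0 * w i0 = a by rewrite divfK.
have bw : r1 * w i1 = b by rewrite divfK.
have cw : r2 * w i2 = a + b by rewrite divfK.
pose A : {mpoly k[3]} := r0 *: 'X_i0; pose B : {mpoly k[3]} := r1 *: 'X_i1.
pose C : {mpoly k[3]} := r2 *: 'X_i2.
have cong i x : x ^+ N = w i ^+ n -> grad_cong w ('X_i ^+ n) (((x / w i) *: 'X_i) ^+ N).
  move=> hx; rewrite exprZn (torus_rho (w0 i) hx); split.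
    by rewrite mevalZ !rmorphXn /= mevalXU -exprD addn1 addnS.
  move=> j; rewrite mderivZ !mderiv_Xn !mevalZ !rmorphXn /= mevalXU.
  rewrite !natrM natn1 // natN1 // !mulr1 mulrCA -exprD.
  by rewrite !addn1.
have [_ FE] : grad_cong w F (\prod_(x <- unity_pairs) line_factor A B C x).
  by rewrite -bh_lines; apply: (bh_cong _ (grad_congP w)); apply: cong.
have L0 x : (line_factor A B C x).@[w] = (a + b) - x.2 * (a + x.1 * b).
  by rewrite /line_factor mevalB mevalM mevalD mevalM !mevalC !mevalZ !mevalXU aw bw cw.
have dL x : ((line_factor A B C x)^`M(i2)).@[w] = r2.
  rewrite /line_factor /A /B /C mderivB !mderiv_mulC mderivD mderiv_mulC !mderivZ !mderiv_var /=.
  by rewrite !mpolyC0 !scaler0 mulr0 addr0 mulr0 subr0 mevalZ mevalC mulr1.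
have r20 : r2 != 0 by rewrite mulf_neq0 ?invr_neq0 // (torus_coord (w0 i2) hc).
have p11 : (1, 1) \in unity_pairs by rewrite mem_unity_pairs expr1n eqxx.
have := @grad_prod_eq0 _ w _ _ (line_factor A B C) (1, 1) i2 uniq_unity_pairs p11.
rewrite dL L0 /= !mul1r subrr => /(_ erefl r20) main; split.
  move=> g0; have [|[z e] [ze ze1]] := proj1 main; first by move=> i; rewrite -FE.
  by rewrite L0 => /eqP; rewrite subr_eq0 => /eqP E; exists z, e; split.
case=> z [e [_ ze ze1 E]] i; rewrite FE; apply: (proj2 main) i; exists (z, e); split=> //.
by rewrite L0 E subrr.
Qed.

(** Invariant under rescaling w.  Here t = b / a is an element of F_(q^2) outside
    F_q, and t^N, (1 + t)^N are the norms of t and 1 + t. *)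
Definition node_vec (w : 'I_3 -> k) : Prop := exists t c,
  [/\ t ^+ (q ^ 2) = t, t ^+ q != t, w i0 ^+ n = c, w i1 ^+ n = c * t ^+ N &
      w i2 ^+ n = c * (1 + t) ^+ N].

(** From t one recovers z = t^(q-1) and e = (1 + t)^(1-q), which are N-th roots
    of unity because t and 1 + t are fixed by the q^2-power map. *)
Lemma node_vecP (w : 'I_3 -> k) : (forall i, w i != 0) ->
  node_vec w <-> exists a b z e, on_two_lines w a b z e.
Proof.
move=> w0; split=> [[t [c [tq2 tq h0 h1 h2]]]|].
  have c0 : c != 0 by rewrite -h0 expf_neq0.
  have t1 : 1 + t != 0.
    by have := expf_neq0 n (w0 i2); rewrite h2 mulf_eq0 expf_eq0 (negPf c0).
  have t0 : t != 0.
    by have := expf_neq0 n (w0 i1); rewrite h1 mulf_eq0 expf_eq0 (negPf c0).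
  have t1q : 1 + t ^+ q = (1 + t) ^+ q by rewrite exprqD // expr1n.
  have t1q2 : (1 + t) ^+ (q ^ 2) = 1 + t by rewrite -mulnn exprM -t1q exprqD // expr1n -exprM mulnn tq2.
  have tq0 : 1 + t ^+ q != 0 by rewrite t1q expf_neq0.
  have normq (x : k) : x != 0 -> x ^+ (q ^ 2) = x -> (x ^+ q / x) ^+ N = 1.
    move=> x0 xq; rewrite expr_div_n -exprM mulnS mulnn exprD xq (exprS x).
    by rewrite (mulrC (x ^+ q)) divff // mulf_neq0 ?expf_neq0.
  pose a := nroot N c; have aN : a ^+ N = c by rewrite nrootK.
  exists a, (a * t), (t ^+ q / t), ((1 + t) / (1 + t ^+ q)); split.
  - have -> : a + a * t = a * (1 + t) by rewrite mulrDr mulr1.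
    by rewrite !exprMn aN.
  - rewrite mem_unity_pairs normq // eqxx /= t1q -invf_div exprVn normq //.
    by rewrite invr1.
  - rewrite xpair_eqE negb_and; apply/orP; left.
    by apply: contra_neq tq => h; rewrite -[LHS](divfK t0) h mul1r.
  by field; rewrite tq0 t0.
case=> a [b [z [e [[ha hb hc] ze ze1 E]]]].
have a0 := torus_coord (w0 i0) ha; have b0 := torus_coord (w0 i1) hb.
have ab0 := torus_coord (w0 i2) hc.
have [hz z1 _ _] := second_line a0 b0 ab0 ze ze1 E.
have tq : (b / a) ^+ q = z * (b / a).
  rewrite expr_div_n hz -[in LHS](prednK (ltnW q_gt1)) exprS; field.
  by rewrite a0 expf_neq0.
have zM : z \in nroots N 1 by move: ze; rewrite mem_unity_pairs mem_nroots // => /andP[].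
exists (b / a), (a ^+ N); split=> //.
- rewrite -mulnn exprM tq exprMn tq (unity_exprq zM) mulKf //.
  exact: (unity_neq0 (ltn0Sn q) zM).
- rewrite tq; apply: contra_neq z1 => h.
  by apply: (mulIf (_ : b / a != 0)); rewrite ?mul1r // mulf_neq0 ?invr_neq0.
- by rewrite -exprMn mulrC divfK // hb.
by rewrite -exprMn mulrDr mulr1 (mulrC a) divfK // hc.
Qed.

Lemma torus_singular (w : 'I_3 -> k) : (forall i, w i != 0) ->
  (F.@[w] = 0 /\ forall i, (F^`M(i)).@[w] = 0) <-> node_vec w.
Proof.
move=> w0; rewrite node_vecP //; split=> [[/eqP]|[a [b [z [e H]]]]].
  rewrite meval_dual_eq => /(bh_eq0P q_gt1 q_char)[a [b [ha hb hc]]] g0.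
  exists a, b; exact/(torus_gradient w0 (esym ha) (esym hb) (esym hc)).
have [[ha hb hc] _ _ _] := H; split.
  rewrite meval_dual_eq; apply/eqP/(bh_eq0P q_gt1 q_char).
  by exists a, b; rewrite ha hb hc.
by apply/(torus_gradient w0 ha hb hc); exists z, e.
Qed.

End Torus.

(** * Ordinary nodes *)

Definition mon2 (i j : nat) : 'X_{1..2} := [multinom [tuple i; j]].

Lemma mon2_0 i j : mon2 i j 0 = i. Proof. by rewrite /mon2 multinomE. Qed.
Lemma mon2_1 i j : mon2 i j 1 = j. Proof. by rewrite /mon2 multinomE. Qed.

Lemma mon2P (m m' : 'X_{1..2}) : m 0 = m' 0 -> m 1 = m' 1 -> m = m'.
Proof.
move=> h0 h1; apply/mnmP => -[[|[|//]] lt].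
  by rewrite (_ : Ordinal lt = 0) //; apply: val_inj.
by rewrite (_ : Ordinal lt = 1) //; apply: val_inj.
Qed.

Lemma eq_mon2 i j i' j' : (mon2 i j == mon2 i' j') = (i == i') && (j == j').
Proof.
apply/eqP/andP => [h|[/eqP-> /eqP->]//].
have := congr1 (fun m : 'X_{1..2} => m 0) h; have := congr1 (fun m : 'X_{1..2} => m 1) h.
by rewrite !mon2_0 !mon2_1 => -> ->.
Qed.

Lemma mon2D i j i' j' : (mon2 i j + mon2 i' j')%MM = mon2 (i + i') (j + j').
Proof. by apply: mon2P; rewrite mnmDE !(mon2_0, mon2_1). Qed.

Lemma mon2_U0 : U_(0%R)%MM = mon2 1 0.
Proof. by apply: mon2P; rewrite mnm1E !(mon2_0, mon2_1). Qed.
Lemma mon2_U1 : U_(1%R)%MM = mon2 0 1.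
Proof. by apply: mon2P; rewrite mnm1E !(mon2_0, mon2_1). Qed.

Lemma mdeg_mon2 i j : mdeg (mon2 i j) = (i + j)%N.
Proof.
rewrite mdegE !big_ord_recl big_ord0 addn0 -[i in RHS](mon2_0 i j) -[j in RHS](mon2_1 i j).
by congr (_ + _)%N; congr (mon2 i j _); apply: val_inj.
Qed.

Lemma ordinary_node_jet (k : fieldType) (f : {mpoly k[2]}) (r al be ga de : k) :
    r != 0 -> al * de - be * ga != 0 ->
    ord_ge 3 (f - r *: ((al *: 'X_0 + be *: 'X_1) * (ga *: 'X_0 + de *: 'X_1))) ->
  ordinary_node (series2_of_mpoly f).
Proof.
move=> r0 det; rewrite (_ : r *: _ = (r * (al * ga)) *: 'X_[mon2 2 0]
    + (r * (al * de + be * ga)) *: 'X_[mon2 1 1] + (r * (be * de)) *: 'X_[mon2 0 2]); last first.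
  have X20 : 'X_[mon2 2 0] = 'X_0 * 'X_0 :> {mpoly k[2]} by rewrite -mpolyXD mon2_U0 mon2D.
  have X11 : 'X_[mon2 1 1] = 'X_0 * 'X_1 :> {mpoly k[2]} by rewrite -mpolyXD mon2_U0 mon2_U1 mon2D.
  have X02 : 'X_[mon2 0 2] = 'X_1 * 'X_1 :> {mpoly k[2]} by rewrite -mpolyXD mon2_U1 mon2D.
  by rewrite X20 X11 X02 -!mul_mpolyC !(mpolyCM, mpolyCD); ring.
set g := (X in f - X) => ord; have fE i j : (i + j < 3)%N -> f@_(mon2 i j) = g@_(mon2 i j).
  move=> lt; apply/eqP; rewrite -subr_eq0 -mcoeffB; apply/eqP; apply: ord.
  by rewrite mdeg_mon2.
split.
1-3: by rewrite /series2_of_mpoly fE // !mcoeffD !mcoeffZ !mcoeffX !eq_mon2 /= !mulr0 !addr0.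
exists (r * al), (r * be), ga, de.
split; rewrite /series2_of_mpoly ?fE // ?mcoeffD ?mcoeffZ ?mcoeffX ?eq_mon2 /= ?mulr0 ?mulr1 ?addr0 ?add0r ?mulrA //.
- by rewrite -mulrA -(mulrA r) -mulrBr mulf_neq0.
by rewrite mulrDr !mulrA.
Qed.

Section NodeJet.
Variables (k : closedFieldType) (q : nat).
Hypotheses (q_gt1 : (1 < q)%N) (q_char : [pchar k].-nat q).

Local Notation N := q.+1.
Local Notation n := (q ^ 2 + q + 1)%N.
Local Notation F := (dual_eq k q).

(** Replacing l_i^n by the N-th power of rho_i l_i changes it by a multiple of
    lam_i^(q^2), of order greater than 3.  In the resulting product of lines,
    [second_line] shows that exactly two factors vanish at the origin, and the
    others contribute a nonzero constant r up to higher order. *)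
Lemma node_jet m (w : 'I_3 -> k) (lam : 'I_3 -> {mpoly k[m]}) a b z e :
    (forall i, w i != 0) -> on_two_lines q w a b z e -> (forall i, ord_ge 1 (lam i)) ->
  let rho0 := a / w i0 in let rho1 := b / w i1 in let rho2 := (a + b) / w i2 in
  let l i := (w i)%:MP + lam i in
  exists2 r, r != 0 & ord_ge 3 (bh q (l i0 ^+ n) (l i1 ^+ n) (l i2 ^+ n) - r *:
    ((rho2 *: lam i2 - (rho0 *: lam i0 + rho1 *: lam i1)) *
     (rho2 *: lam i2 - e *: (rho0 *: lam i0 + z *: (rho1 *: lam i1))))).
Proof.
move=> w0 [[ha hb hc] ze ze1 E] lam1 r0 r1 r2 l.
have aw : r0 * w i0 = a by rewrite divfK.
have bw : r1 * w i1 = b by rewrite divfK.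
have cw : r2 * w i2 = a + b by rewrite divfK.
have cong i x : x ^+ N = w i ^+ n -> ord_ge 3 (l i ^+ n - ((x / w i) *: l i) ^+ N).
  move=> hx; rewrite exprZn (torus_rho (w0 i) hx) -addnA addn1 exprD.
  rewrite -mul_mpolyC -mulrBl; apply: ord_geMr.
  rewrite /l exprDn_pchar; last first.
    by rewrite (eq_pnat _ (pchar_lalg _)) pnatX q_char.
  rewrite (rmorphXn (@mpolyC m k)) /= addrC addKr; apply: (@ord_geW _ _ (q ^ 2 * 1)%N).
    by rewrite muln1 (leq_trans _ (_ : 2 ^ 2 <= _)%N) // leq_exp2r.
  exact: ord_geX.
have [a0 b0 ab0] : [/\ a != 0, b != 0 & a + b != 0].
  by rewrite (torus_coord (w0 i0) ha) (torus_coord (w0 i1) hb) (torus_coord (w0 i2) hc).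
set L := line_factor (r0 *: l i0) (r1 *: l i1) (r2 *: l i2).
have Ff : ord_ge 3 (bh q (l i0 ^+ n) (l i1 ^+ n) (l i2 ^+ n) - \prod_(x <- unity_pairs k q) L x).
  by rewrite -(bh_lines q_gt1 q_char); apply: (bh_cong _ (ord_ge_cong k m 3)); apply: cong.
have p11 : (1, 1) \in unity_pairs k q by rewrite mem_unity_pairs expr1n eqxx.
move: Ff; rewrite (bigD1_seq (1, 1)) //= ?uniq_unity_pairs //.
rewrite -big_filter (bigD1_seq (z, e)) /=; last 2 first.
- by rewrite mem_filter ze1.
- by rewrite filter_uniq ?uniq_unity_pairs.
rewrite -big_filter; set s := filter _ _; set R := \prod_(x <- s) _ => Ff.
have L0 x : (L x)@_0 = (a + b) - x.2 * (a + x.1 * b).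
  have l0 i c : (c *: l i)@_0 = c * w i.
    by rewrite mcoeffZ /l mcoeffD mcoeffC eqxx mulr1 lam1 ?addr0 ?mdeg0.
  by rewrite /L /line_factor mcoeffB !mcoeffCM mcoeffD mcoeffCM !l0 aw bw cw.
exists R@_0.
  have -> : R@_0 = \prod_(x <- s) (L x)@_0 by rewrite /R (rmorph_prod (mcoeff 0%MM)).
  rewrite prodf_seq_neq0; apply/allP => -[z' e']; rewrite !mem_filter /= => /andP[ne /andP[ne1 ze']].
  rewrite L0 /= subr_eq0; apply: contra_neqN ne => /eqP E'.
  have [hz _ _ _] := second_line q_gt1 q_char a0 b0 ab0 ze ze1 E.
  have [hz' _ _ _] := second_line q_gt1 q_char a0 b0 ab0 ze' ne1 E'.
  have zz : z' = z.
    by apply: (mulIf (_ : b * a ^+ q.-1 != 0)); rewrite -?hz' // mulf_neq0 ?expf_neq0.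
  move: E'; rewrite zz {1}E => /mulIf -> //.
  by apply: contraNneq ab0 => h; rewrite E h mulr0.
(* The two lines through the point have no constant term. *)
set M1 := _ - (_ + _); set M2 := _ - e *: _.
have LM1 : L (1, 1) = M1.
  rewrite /L /line_factor /M1 /l /= !mul1r !scalerDr -!mul_mpolyC -!mpolyCM aw bw cw.
  by rewrite mpolyCD; ring.
have LM2 : L (z, e) = M2.
  rewrite /L /line_factor /M2 /l /= !scalerDr -!mul_mpolyC -!mpolyCM aw bw cw.
  by rewrite E mpolyCM mpolyCD mpolyCM; ring.
have M1_1 : ord_ge 1 M1.
  by apply: ord_geD; last apply/ord_geN/ord_geD; apply: ord_geZ.
have M2_1 : ord_ge 1 M2.
  apply: ord_geD; last apply/ord_geN/ord_geZ; first exact: ord_geZ.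
  by apply: ord_geD; first exact: ord_geZ; apply/ord_geZ/ord_geZ.
set f := bh _ _ _ _ in Ff *; rewrite LM1 LM2 in Ff.
rewrite (_ : _ - _ = (f - M1 * (M2 * R)) + (M1 * M2) * (R - (R@_0)%:MP)); last first.
  by rewrite -mul_mpolyC; ring.
apply: ord_geD => //; apply: (@ord_geM _ _ 2 1) (ord_ge_const R).
exact: (@ord_geM _ _ 1 1).
Qed.

Definition chart_var (i j : 'I_3) : {mpoly k[2]} :=
  if unlift i j is Some s then 'X_s else 0.

Lemma chart_var_self i : chart_var i i = 0.
Proof. by rewrite /chart_var unlift_none. Qed.

Lemma chart_var_lift i j s : j = lift i s -> chart_var i j = 'X_s.
Proof. by move=> ->; rewrite /chart_var liftK. Qed.

Lemma local_dual_eq (P : P2 k) i (u := fun j => coords P 0 j / coords P 0 i)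
    (l := fun j => (u j)%:MP + chart_var i j) : coords P 0 i != 0 ->
  local_equation F P i = bh q (l i0 ^+ n) (l i1 ^+ n) (l i2 ^+ n).
Proof.
move=> Pi; rewrite /local_equation /dual_eq rmorph_bh /= !rmorphXn /= !comp_mpolyXU -!tnth_nth !tnth_mktuple.
have lE j : (if unlift i j is Some s then (coords P 0 j / coords P 0 i)%:MP + 'X_s else 1) = l j.
  rewrite /l /u /chart_var; have [s ->//|->] := unliftP i j.
  by rewrite divff // addr0.
by rewrite !lE.
Qed.

Lemma node_vecZ (v : 'I_3 -> k) c : c != 0 -> node_vec q v -> node_vec q (fun i => v i * c).
Proof.
move=> c0 [t [d [h1 h2 e0 e1 e2]]]; exists t, (d * c ^+ n); split=> //; rewrite exprMn ?e0 //.
  by rewrite e1 mulrAC.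
by rewrite e2 mulrAC.
Qed.

Lemma node_at (P : P2 k) : (forall i, coords P 0 i != 0) ->
  node_vec q (fun i => coords P 0 i) -> ordinary_node_at F P.
Proof.
move=> P0 hP i Pi; rewrite local_dual_eq //.
set u := fun j => coords P 0 j / coords P 0 i.
have u0 j : u j != 0 by rewrite mulf_neq0 ?invr_neq0.
have /(node_vecP q_gt1 q_char u0)[a [b [z [e H]]]] : node_vec q u.
  by apply: node_vecZ; rewrite // invr_neq0.
have lam1 j : ord_ge 1 (chart_var i j).
  by rewrite /chart_var; case: unlift => [s|]; [apply: ord_ge_var | apply: ord_ge_zero].
have [r r0] := node_jet u0 H lam1.
have [[ha hb hc] ze ze1 E] := H.
have a0 := torus_coord (u0 i0) ha; have b0 := torus_coord (u0 i1) hb.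
have ab0 := torus_coord (u0 i2) hc.
have [_ z1 e1 ez1] := second_line q_gt1 q_char a0 b0 ab0 ze ze1 E.
have e0 : e != 0 by apply: contraNneq ab0 => h; rewrite E h mul0r.
set r0' := a / _; set r1 := b / _; set r2 := (a + b) / _.
have r0'0 : r0' != 0 by rewrite mulf_neq0 ?invr_neq0.
have r10 : r1 != 0 by rewrite mulf_neq0 ?invr_neq0.
have r20 : r2 != 0 by rewrite mulf_neq0 ?invr_neq0.
(* Determinants of the two tangent forms in the charts x_0, x_1 and x_2 = 1. *)
have det1 (x y : k) : x != 0 -> y != 0 -> - x * y - y * - (e * z * x) != 0.
  move=> x0 y0; rewrite (_ : _ - _ = x * y * (e * z - 1)); last by ring.
  by rewrite !mulf_neq0 // subr_eq0.
have det2 (x y : k) : x != 0 -> y != 0 -> - x * y - y * - (e * x) != 0.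
  move=> x0 y0; rewrite (_ : _ - _ = x * y * (e - 1)); last by ring.
  by rewrite !mulf_neq0 // subr_eq0.
have det3 (x y : k) : x != 0 -> y != 0 -> - x * - (e * z * y) - - y * - (e * x) != 0.
  move=> x0 y0; rewrite (_ : _ - _ = x * y * (e * (z - 1))); last by ring.
  by rewrite !mulf_neq0 // subr_eq0.
set f := bh _ _ _ _ => jet.
case: (ord3P i) => ei.
- apply: (ordinary_node_jet r0 (det1 _ _ r10 r20)); move: jet.
  have -> : chart_var i i0 = 0 by rewrite ei chart_var_self.
  have -> : chart_var i i1 = 'X_0 by rewrite ei (@chart_var_lift _ _ 0) //; apply: val_inj.
  have -> : chart_var i i2 = 'X_1 by rewrite ei (@chart_var_lift _ _ 1) //; apply: val_inj.
  congr (ord_ge 3 (f - _ *: _)).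
  by rewrite -!mul_mpolyC !(mpolyCN, mpolyCM); ring.
- apply: (ordinary_node_jet r0 (det2 _ _ r0'0 r20)); move: jet.
  have -> : chart_var i i0 = 'X_0 by rewrite ei (@chart_var_lift _ _ 0) //; apply: val_inj.
  have -> : chart_var i i1 = 0 by rewrite ei chart_var_self.
  have -> : chart_var i i2 = 'X_1 by rewrite ei (@chart_var_lift _ _ 1) //; apply: val_inj.
  congr (ord_ge 3 (f - _ *: _)).
  by rewrite -!mul_mpolyC !(mpolyCN, mpolyCM); ring.
apply: (ordinary_node_jet r0 (det3 _ _ r0'0 r10)); move: jet.
have -> : chart_var i i0 = 'X_0 by rewrite ei (@chart_var_lift _ _ 0) //; apply: val_inj.
have -> : chart_var i i1 = 'X_1 by rewrite ei (@chart_var_lift _ _ 1) //; apply: val_inj.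
have -> : chart_var i i2 = 0 by rewrite ei chart_var_self.
congr (ord_ge 3 (f - _ *: _)).
by rewrite -!mul_mpolyC !(mpolyCN, mpolyCM); ring.
Qed.

End NodeJet.

(** * Milnor numbers of monomial Jacobian ideals *)

Section Milnor.
Variable k : fieldType.
Implicit Types (p r : {mpoly k[2]}) (s t h : series2 k).

Lemma mcoeff_monM p A B i j : ('X_[mon2 A B] * p)@_(mon2 i j) =
  if (A <= i)%N && (B <= j)%N then p@_(mon2 (i - A) (j - B)) else 0.
Proof.
case: ifP => [/andP[Ai Bj]|nle].
  rewrite mulrC -[mon2 i j](_ : (mon2 A B + mon2 (i - A) (j - B))%MM = _) ?mcoeffMX //.
  by rewrite mon2D !subnKC.
rewrite mcoeffM big1 // => -[a b] /= /eqP E; rewrite mcoeffX.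
case: eqP => [ea|_]; last by rewrite mul0r.
have l0 := congr1 (fun m : 'X_{1..2} => m 0) E; have l1 := congr1 (fun m : 'X_{1..2} => m 1) E.
rewrite /= mnmDE -ea !mon2_0 in l0; rewrite /= mnmDE -ea !mon2_1 in l1.
have Ai : (A <= i)%N by rewrite l0 leq_addr.
have Bj : (B <= j)%N by rewrite l1 leq_addr.
by rewrite Ai Bj in nle.
Qed.

Lemma eq_mcoeffM p p' r r' i j :
    (forall a b, (a <= i)%N -> (b <= j)%N -> p@_(mon2 a b) = p'@_(mon2 a b)) ->
    (forall a b, (a <= i)%N -> (b <= j)%N -> r@_(mon2 a b) = r'@_(mon2 a b)) ->
  (p * r)@_(mon2 i j) = (p' * r')@_(mon2 i j).
Proof.
move=> hp hr; rewrite !mcoeffM; apply: eq_bigr => -[a b] /= /eqP E.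
have mE (m : 'X_{1..2}) : m = mon2 (m 0) (m 1) by apply: mon2P; rewrite ?mon2_0 ?mon2_1.
have l0 := congr1 (fun m : 'X_{1..2} => m 0) E; have l1 := congr1 (fun m : 'X_{1..2} => m 1) E.
rewrite /= mnmDE !mon2_0 in l0; rewrite /= mnmDE !mon2_1 in l1.
have ai : (a 0%R <= i)%N /\ (b 0%R <= i)%N.
  by split; rewrite [X in (_ <= X)%N]l0 ?leq_addr ?leq_addl.
have bj : (a 1%R <= j)%N /\ (b 1%R <= j)%N.
  by split; rewrite [X in (_ <= X)%N]l1 ?leq_addr ?leq_addl.
by rewrite (mE a) (mE b) hp ?hr //; [case: ai|case: bj|case: ai|case: bj].
Qed.

Definition trunc (c d : nat) s : {mpoly k[2]} :=
  \sum_(a < c) \sum_(b < d) s a b *: 'X_[mon2 a b].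

Lemma mcoeff_trunc c d s i j : (i < c)%N -> (j < d)%N -> (trunc c d s)@_(mon2 i j) = s i j.
Proof.
move=> ic jd; rewrite raddf_sum (bigD1 (Ordinal ic)) //= raddf_sum (bigD1 (Ordinal jd)) //=.
rewrite mcoeffZ mcoeffX eqxx mulr1 !big1 ?addr0 //.
  move=> a ai; rewrite raddf_sum big1 //= => b _; rewrite mcoeffZ mcoeffX eq_mon2.
  by rewrite (_ : (_ == i) = false) ?mulr0 //; apply: contraNF ai => /eqP h; apply/eqP/val_inj.
move=> b bj; rewrite mcoeffZ mcoeffX eq_mon2 andbC.
by rewrite (_ : (_ == j) = false) ?mulr0 //; apply: contraNF bj => /eqP h; apply/eqP/val_inj.
Qed.

Lemma mul2E s t p r i j :
    (forall a b, (a <= i)%N -> (b <= j)%N -> p@_(mon2 a b) = s a b) ->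
    (forall a b, (a <= i)%N -> (b <= j)%N -> r@_(mon2 a b) = t a b) ->
  mul2 s t i j = (p * r)@_(mon2 i j).
Proof.
move=> hp hr; rewrite (@eq_mcoeffM _ (trunc i.+1 j.+1 s) _ r) //; last first.
  by move=> a b ai bj; rewrite hp // mcoeff_trunc.
rewrite mulr_suml raddf_sum; apply: eq_bigr => a _ /=.
rewrite mulr_suml raddf_sum; apply: eq_bigr => b _ /=.
have ai : (a <= i)%N := ltn_ord a; have bj : (b <= j)%N := ltn_ord b.
by rewrite -scalerAl mcoeffZ mcoeff_monM ai bj hr ?leq_subr.
Qed.

(** A power series is handled through polynomials p d that approximate it
    modulo terms of degree at least d, so that ring identities need only be
    checked between polynomials. *)

Definition coherent (p : nat -> {mpoly k[2]}) :=
  forall d d', (d <= d')%N -> ord_ge d (p d' - p d).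

Implicit Types P Q : nat -> {mpoly k[2]}.

Lemma coherent_const p : coherent (fun=> p).
Proof. by move=> d d' _; rewrite subrr; apply: ord_ge_zero. Qed.

Lemma coherentB P Q : coherent P -> coherent Q -> coherent (fun d => P d - Q d).
Proof.
move=> hp hr d d' dd; have [_ EB _] := ord_ge_cong k 2 d.
exact: EB (hp _ _ dd) (hr _ _ dd).
Qed.

Lemma coherentM P Q : coherent P -> coherent Q -> coherent (fun d => P d * Q d).
Proof.
move=> hp hr d d' dd; have [_ _ EM] := ord_ge_cong k 2 d.
exact: EM (hp _ _ dd) (hr _ _ dd).
Qed.

Lemma coherent_trunc s : coherent (fun d => trunc d d s).
Proof.
move=> d d' dd m lt; have -> : m = mon2 (m 0) (m 1) by apply: mon2P; rewrite ?mon2_0 ?mon2_1.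
have lt' : (m 0%R + m 1%R < d)%N.
  by rewrite -mdeg_mon2 (_ : mon2 _ _ = m) //; apply: mon2P; rewrite ?mon2_0 ?mon2_1.
rewrite mcoeffB !mcoeff_trunc ?subrr //; lia.
Qed.

Definition limit (p : nat -> {mpoly k[2]}) : series2 k :=
  fun i j => (p (i + j).+1)@_(mon2 i j).

Lemma mcoeff_limit P d i j : coherent P -> (i + j < d)%N ->
  (P d)@_(mon2 i j) = limit P i j.
Proof.
move=> hp lt; apply/eqP; rewrite /limit -subr_eq0 -mcoeffB; apply/eqP.
by apply: hp => //; rewrite mdeg_mon2.
Qed.

Lemma mul2_limit P r i j : coherent P ->
  mul2 (limit P) (series2_of_mpoly r) i j = (P (i + j).+1 * r)@_(mon2 i j).
Proof.
move=> hp; apply: mul2E => // a b ai bj; apply: mcoeff_limit => //; lia.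
Qed.

(** Inverse of a polynomial with nonzero constant term, by the geometric series. *)
Definition geom (U : {mpoly k[2]}) (d : nat) : {mpoly k[2]} :=
  (U@_0)^-1 *: \sum_(l < d) (1 - (U@_0)^-1 *: U) ^+ l.

Lemma geom_ord (U : {mpoly k[2]}) : U@_0 != 0 -> ord_ge 1 (1 - (U@_0)^-1 *: U).
Proof.
move=> U0; have := ord_ge_const (1 - (U@_0)^-1 *: U).
by rewrite mcoeffB mcoeff1 eqxx mcoeffZ mulVf // subrr subr0.
Qed.

Lemma coherent_geom (U : {mpoly k[2]}) : U@_0 != 0 -> coherent (geom U).
Proof.
move=> U0 d d' /subnKC <-; rewrite /geom -scalerBr; apply: ord_geZ.
rewrite big_split_ord /= addrAC subrr add0r.
elim/big_ind: _ => [|x y|l _]; [exact: ord_ge_zero | exact: ord_geD|].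
apply: (@ord_geW _ _ ((d + l) * 1)%N); first by rewrite muln1 leq_addr.
exact/ord_geX/geom_ord.
Qed.

Lemma geomK (U : {mpoly k[2]}) d : U@_0 != 0 -> ord_ge d (geom U d * U - 1).
Proof.
move=> U0; have -> : geom U d * U - 1 = - (1 - (U@_0)^-1 *: U) ^+ d.
  set V := (U@_0)^-1 *: U; rewrite /geom -/V -scalerAl scalerAr -/V.
  have := subrXX 1 (1 - V) d; rewrite expr1n subKr => h.
  rewrite (eq_bigr (fun i : 'I_d => 1 ^+ (d.-1 - i) * (1 - V) ^+ i)) => [|i _].
    by rewrite mulrC -h addrAC subrr add0r.
  by rewrite expr1n mul1r.
apply: ord_geN; rewrite -[d in ord_ge d _]muln1; exact/ord_geX/geom_ord.
Qed.

(** M' is V^-1 g', and M is U^-1 (g - M' S): solving the triangular system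
    expresses M h1 + M' h2 through g and g'.  Here M and M' stand for powers of
    the two variables, in either order. *)
Lemma jacobian_box (g g' M M' U V S : {mpoly k[2]}) (h h1 h2 : series2 k) :
    U@_0 != 0 -> V@_0 != 0 -> g = M * U + M' * S -> g' = M' * V ->
    (forall i j d, (i + j < d)%N -> h i j = (M * trunc d d h1 + M' * trunc d d h2)@_(mon2 i j)) ->
  exists a b : series2 k, forall i j,
    h i j = mul2 a (series2_of_mpoly g) i j + mul2 b (series2_of_mpoly g') i j.
Proof.
move=> U0 V0 gE g'E hE.
pose H1 d := trunc d d h1; pose H2 d := trunc d d h2.
pose a d := H1 d * geom U d; pose b d := (H2 d - a d * S) * geom V d.
have ca : coherent a := coherentM (coherent_trunc h1) (coherent_geom U0).
have cb : coherent b.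
  apply: coherentM (coherent_geom V0); apply: coherentB (coherent_trunc h2) _.
  exact: coherentM ca (coherent_const S).
exists (limit a), (limit b) => i j; rewrite !mul2_limit //; set d := (i + j).+1.
rewrite -mcoeffD (hE _ _ d) //; apply/eqP; rewrite eq_sym -subr_eq0 -mcoeffB; apply/eqP.
rewrite (_ : _ - _ = (geom U d * U - 1) * (M * H1 d) + (geom V d * V - 1) * (M' * (H2 d - a d * S))).
  have := ord_geMr (M * H1 d) (geomK (d := d) U0); have := ord_geMr (M' * (H2 d - a d * S)) (geomK (d := d) V0).
  by move=> h4 h3; apply: (ord_geD h3 h4); rewrite mdeg_mon2.
rewrite gE g'E /b -/(H1 d) -/(H2 d) /a; ring.
Qed.

Lemma mul2_box (A B : nat) (a t : series2 k) :
    (forall i j, (i < A)%N -> (j < B)%N -> t i j = 0) ->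
  forall i j, (i < A)%N -> (j < B)%N -> mul2 a t i j = 0.
Proof.
move=> t0 i j iA jB; rewrite /mul2 big1 // => x _; rewrite big1 // => y _.
by rewrite t0 ?mulr0 //; apply: leq_ltn_trans (leq_subr _ _) _.
Qed.

(** The monomials x^i y^j with i < A and j < B form a basis of the quotient; the
    index l stands for the pair (l / B, l mod B). *)
Lemma milnor_box (f : series2 k) A B :
    (forall h, jacobian_ideal f h <-> forall i j, (i < A)%N -> (j < B)%N -> h i j = 0) ->
  milnor_number f (A * B).
Proof.
have [-> jac|B0 jac] := posnP B.
  rewrite muln0; exists (fun _ _ _ => 0) => h; exists 0; split=> [|c _]; last first.
    by apply/rowP => -[].
  by apply/jac => i j _; rewrite ltn0.
exists (fun l i j => ((i == (l %/ B)%N) && (j == (l %% B)%N))%:R) => h.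
have sumE (c : 'rV[k]_(A * B)) i j (iA : (i < A)%N) (jB : (j < B)%N) (l : 'I_(A * B)) :
    i = (l %/ B)%N -> j = (l %% B)%N ->
    \sum_(l < A * B) c 0 l * ((i == (l %/ B)%N) && (j == (l %% B)%N))%:R = c 0 l.
  move=> hi hj; rewrite (bigD1 l) //= hi hj !eqxx mulr1 big1 ?addr0 // => l' ne.
  case: andP => [[/eqP h1 /eqP h2]|_]; last by rewrite mulr0.
  by case/eqP: ne; apply: val_inj; rewrite /= (divn_eq l' B) -h1 -h2 -divn_eq.
pose c : 'rV[k]_(A * B) := \row_l h (l %/ B)%N (l %% B)%N.
have lt i j : (i < A)%N -> (j < B)%N -> (i * B + j < A * B)%N.
  move=> iA jB; apply: (@leq_trans (i.+1 * B)); last by rewrite leq_mul2r iA orbT.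
  by rewrite mulSn addnC ltn_add2r.
exists c; split=> [|c' /jac hc'].
  apply/jac => i j iA jB; pose l := Ordinal (lt i j iA jB).
  have hi : i = (l %/ B)%N by rewrite /= divnMDl // divn_small // addn0.
  have hj : j = (l %% B)%N by rewrite /= modnMDl modn_small.
  by rewrite (sumE _ _ _ iA jB l hi hj) mxE -hi -hj subrr.
apply/rowP => l; rewrite mxE; have lB : (l %% B < B)%N by rewrite ltn_mod.
have lA : (l %/ B < A)%N by rewrite ltn_divLR.
by have := hc' _ _ lA lB; rewrite (sumE _ _ _ lA lB l) // => /eqP; rewrite subr_eq0 => /eqP.
Qed.

Lemma dx_series (f : {mpoly k[2]}) i j : dx (series2_of_mpoly f) i j = series2_of_mpoly f^`M(0%R) i j.
Proof.
rewrite /dx /series2_of_mpoly mcoeff_deriv -!/(mon2 _ _) mon2_0 mon2_U0 mon2D.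
by rewrite addn1 addn0.
Qed.

Lemma dy_series (f : {mpoly k[2]}) i j : dy (series2_of_mpoly f) i j = series2_of_mpoly f^`M(1%R) i j.
Proof.
rewrite /dy /series2_of_mpoly mcoeff_deriv -!/(mon2 _ _) mon2_1 mon2_U1 mon2D.
by rewrite addn1 addn0.
Qed.

Lemma eq_mul2r (a s t : series2 k) : s =2 t -> mul2 a s =2 mul2 a t.
Proof.
move=> st i j; apply: eq_bigr => x _; apply: eq_bigr => y _.
by rewrite st.
Qed.

Lemma jacobian_idealE (f : {mpoly k[2]}) h : jacobian_ideal (series2_of_mpoly f) h <->
  exists a b : series2 k, forall i j, h i j =
    mul2 a (series2_of_mpoly f^`M(0%R)) i j + mul2 b (series2_of_mpoly f^`M(1%R)) i j.
Proof.
split=> -[a [b hab]]; exists a, b => i j; rewrite hab.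
  by rewrite (eq_mul2r a (dx_series f)) (eq_mul2r b (dy_series f)).
by rewrite (eq_mul2r a (dx_series f)) (eq_mul2r b (dy_series f)).
Qed.

Section MonomialJacobian.
Variables (f U V S : {mpoly k[2]}) (A B : nat).
Hypotheses (U0 : U@_0 != 0) (V0 : V@_0 != 0).

Lemma mcoeff_box (p r : {mpoly k[2]}) i j : (i < A)%N -> (j < B)%N ->
  ('X_[mon2 A 0] * p + 'X_[mon2 0 B] * r)@_(mon2 i j) = 0.
Proof.
by move=> iA jB; rewrite mcoeffD !mcoeff_monM (leqNgt A) iA (leqNgt B) jB /= addr0.
Qed.

Lemma box_split (h : series2 k) : (forall i j, (i < A)%N -> (j < B)%N -> h i j = 0) ->
  forall i j d, (i + j < d)%N -> h i j =
    ('X_[mon2 A 0] * trunc d d (fun i j => h (i + A)%N j) +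
     'X_[mon2 0 B] * trunc d d (fun i j => if (i < A)%N then h i (j + B)%N else 0))@_(mon2 i j).
Proof.
move=> h0 i j d lt; rewrite mcoeffD !mcoeff_monM /= !subn0 andbT.
have [iA|Ai] := ltnP i A.
  rewrite add0r; case: leqP => [Bj|jB]; last exact: h0.
  by rewrite mcoeff_trunc ?iA ?subnK //; lia.
rewrite mcoeff_trunc ?subnK //; [|lia|lia].
case: leqP => [Bj|jB]; last by rewrite addr0.
by rewrite mcoeff_trunc ?ltnNge ?Ai ?addr0 //; rewrite -?ltnNge; lia.
Qed.

Lemma milnor_x : f^`M(0%R) = 'X_[mon2 A 0] * U + 'X_[mon2 0 B] * S ->
    f^`M(1%R) = 'X_[mon2 0 B] * V ->
  milnor_number (series2_of_mpoly f) (A * B).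
Proof.
move=> f0 f1; apply: milnor_box => h; rewrite jacobian_idealE; split; last first.
  by move=> h0; apply: (jacobian_box U0 V0 f0 f1 (box_split h0)).
case=> a [b hab] i j iA jB; rewrite hab !(@mul2_box A B) ?addr0 // => i' j' iA' jB'.
  by rewrite /series2_of_mpoly -/(mon2 _ _) f1 -['X_[_] * V]add0r -(mulr0 'X_[mon2 A 0]) mcoeff_box.
by rewrite /series2_of_mpoly -/(mon2 _ _) f0 mcoeff_box.
Qed.

Lemma milnor_y : f^`M(1%R) = 'X_[mon2 0 B] * U + 'X_[mon2 A 0] * S ->
    f^`M(0%R) = 'X_[mon2 A 0] * V ->
  milnor_number (series2_of_mpoly f) (A * B).
Proof.
move=> f1 f0; apply: milnor_box => h; rewrite jacobian_idealE; split; last first.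
  move=> h0; have [|b [a hab]] := jacobian_box U0 V0 f1 f0 (h := h)
      (h1 := fun i j => if (i < A)%N then h i (j + B)%N else 0)
      (h2 := fun i j => h (i + A)%N j).
    by move=> i j d lt; rewrite addrC; apply: box_split.
  by exists a, b => i j; rewrite hab addrC.
case=> a [b hab] i j iA jB; rewrite hab !(@mul2_box A B) ?addr0 // => i' j' iA' jB'.
  by rewrite /series2_of_mpoly -/(mon2 _ _) f1 addrC mcoeff_box.
by rewrite /series2_of_mpoly -/(mon2 _ _) f0 -['X_[_] * V]addr0 -(mulr0 'X_[mon2 0 B]) mcoeff_box.
Qed.

End MonomialJacobian.

End Milnor.

(** * Points on the coordinate axes *)

Section Edge.
Variables (R S : comNzRingType) (q : nat) (phi : {rmorphism R -> S}).
Hypotheses (q_gt1 : (1 < q)%N) (q_char : [pchar R].-nat q).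
Local Notation N := q.+1.

(** The value of K when Z = 0 is the derivative of D_m in W; at W = -2, P = 1
    both roots of T^2 - W T + P are -1 and the derivative is m times the sum of
    the m products u^i v^(m-1-i). *)
Lemma dickson_shift (W Z P : R) m : exists K,
  dickson (W + Z) P m = dickson W P m + Z * K /\
  (phi W = - 2%:R -> phi P = 1 -> phi Z = 0 -> phi K = (m ^ 2)%:R * (- 1) ^+ m.+1).
Proof.
elim/nat_ind2: m => [||m [K0 [E0 h0]] [K1 [E1 h1]]].
- by exists 0; rewrite mulr0 addr0 rmorph0 mul0r.
- by exists 1; rewrite mulr1 rmorph1 expr2 mulrNN !mulr1.
exists (dickson W P m.+1 + Z * K1 + W * K1 - P * K0); split.
  by rewrite !dicksonSS E0 E1; ring.
move=> hW hP hZ; rewrite !(rmorphB, rmorphD, rmorphM) rmorph_dickson h0 // h1 // hW hP hZ.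
have -> : dickson (- 2%:R) 1 m.+1 = (- 1) ^+ m.+1 + (- 1) ^+ m.+1 :> S.
  by rewrite -dickson_sum mulrNN mulr1 -opprD.
rewrite mul0r addr0 mul1r !exprS -[m.+2]addn2 -[m.+1]addn1 !natrX !natrD; ring.
Qed.

Lemma dickson_lead (W P : R) m : exists K,
  dickson W P m.+1 = W ^+ m.+1 + P * K /\
  (phi W = 0 -> phi P = 0 -> (1 < m)%N -> phi K = 0).
Proof.
elim/nat_ind2: m => [||m [K0 [E0 h0]] [K1 [E1 h1]]].
- by exists 0; rewrite mulr0 addr0.
- by exists (- 2%:R); split=> //=; rewrite expr2; ring.
exists (W * K1 - dickson W P m.+1); split.
  by rewrite dicksonSS E1 (exprS W m.+2); ring.
move=> hW hP _; rewrite rmorphB rmorphM hW mul0r E0 rmorphD rmorphXn rmorphM hW hP.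
by rewrite expr0n mul0r addr0 subrr.
Qed.

(** For Z = 0 the Dickson polynomial is evaluated at u = - X and v = - Y, so
    that bh X Y 0 = (X^q - Y^q) (X - Y).  The morphism [phi] will be the
    evaluation at the singular point, where E must not vanish. *)
Lemma bh_edgeZ (X Y Z : R) : exists E,
  bh q X Y Z = (X - Y) ^+ N + Z * E /\
  (phi X = 1 -> phi Y = 1 -> phi Z = 0 -> phi E = (N ^ 2)%:R * (- 1) ^+ N.+1).
Proof.
have [K [E h]] := dickson_shift (- X - Y) Z (X * Y) N.
exists K; split; last by move=> hX hY; apply: h; rewrite ?rmorphM ?rmorphB ?rmorphN hX hY; ring.
rewrite /bh (_ : Z - X - Y = - X - Y + Z); last by ring.
rewrite E -(mulrNN X Y) dickson_sum !exprqSN // !exprSr exprqB //; ring.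
Qed.

(** For X = 0 only the leading term (Z - Y)^N of the Dickson polynomial remains.
    In the coefficient of X, the term - Y^q is the only one that survives at
    (0, 1, 1). *)
Lemma bh_edgeX (X Y Z : R) : exists E,
  bh q X Y Z = (Z - Y) ^+ N + X * E /\
  (phi X = 0 -> phi Y = 1 -> phi Z = 1 -> phi E = - 1).
Proof.
have [K [E h]] := dickson_lead (Z - X - Y) (X * Y) q.
exists (Y * K - X ^+ q.-1 * Y - Y ^+ q - (Z - Y) ^+ q - X ^+ q.-1 * (Z - Y) + X ^+ q).
have q0 : q = q.-1.+1 by rewrite prednK // ltnW.
split.
  rewrite /bh E !exprSr (_ : Z - X - Y = (Z - Y) - X) ?(exprqB q_gt1 q_char (Z - Y)); last by ring.
  have -> : X ^+ q = X * X ^+ q.-1 by rewrite -exprS -q0.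
  by ring.
move=> hX hY hZ; have hK : phi K = 0.
  by apply: h; rewrite ?rmorphM ?rmorphB ?hX ?hY ?hZ ?mul0r // subr0 subrr.
rewrite !(rmorphB, rmorphD, rmorphM, rmorphXn) hK hX hY hZ subrr expr1n !expr0n.
have -> : (q == 0%N) = false by rewrite q0.
have -> : (q.-1 == 0%N) = false by apply/negbTE; rewrite -lt0n -ltnS -q0.
by rewrite !mul0r mulr0 !subr0 addr0 sub0r.
Qed.

(** The three axes at once; the two possible values of phi E come from
    [bh_edgeZ] and [bh_edgeX].  The power N makes the sign of v i - v l
    irrelevant. *)
Lemma bh_edge (v : 'I_3 -> R) i l j : i != l -> i != j -> l != j -> exists E,
  bh q (v i0) (v i1) (v i2) = (v i - v l) ^+ N + v j * E /\
  (phi (v i) = 1 -> phi (v l) = 1 -> phi (v j) = 0 ->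
   phi E = (N ^ 2)%:R * (- 1) ^+ N.+1 \/ phi E = - 1).
Proof.
wlog : i l / (val i < val l)%N.
  move=> main il ij lj; have [lt|gt|/val_inj/eqP] := ltngtP (val i) (val l); last by rewrite (negPf il).
    exact: main.
  have [] := main l i gt _ lj ij; first by rewrite eq_sym.
  by move=> E [EE h]; exists E; split; [rewrite EE -(opprB (v i)) exprqSN | move=> *; apply: h].
case: (ord3P i) => ->; case: (ord3P l) => -> //=; case: (ord3P j) => -> // _ _ _ _.
- have [E [EE h]] := bh_edgeZ (v i0) (v i1) (v i2).
  by exists E; split=> // *; left; apply: h.
- have [E [EE h]] := bh_edgeX (v i1) (v i0) (v i2).
  exists E; split; first by rewrite bhC EE -(opprB (v i2)) exprqSN.
  by move=> *; right; apply: h.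
have [E [EE h]] := bh_edgeX (v i0) (v i1) (v i2).
exists E; split; first by rewrite EE -(opprB (v i2)) exprqSN.
by move=> *; right; apply: h.
Qed.

End Edge.

Section MilnorPoint.
Variables (k : closedFieldType) (q : nat).
Hypotheses (q_gt1 : (1 < q)%N) (q_char : [pchar k].-nat q).

Local Notation N := q.+1.
Local Notation n := (q ^ 2 + q + 1)%N.
Local Notation F := (dual_eq k q).

Lemma mpoly_pchar m : [pchar {mpoly k[m]}].-nat q.
Proof. by rewrite (eq_pnat _ (pchar_lalg _)). Qed.

Lemma edge_gradient (w : 'I_3 -> k) i l j : i != l -> i != j -> l != j ->
    w j = 0 -> w i ^+ n = w l ^+ n ->
  F.@[w] = 0 /\ forall h, (F^`M(h)).@[w] = 0.
Proof.
move=> il ij lj wj wil; have qm := mpoly_pchar 3.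
have [E [EE _]] := bh_edge idfun q_gt1 qm (fun i => 'X_i ^+ n : {mpoly k[3]}) il ij lj.
have n1 : n.-1 = (q * N)%N := n_pred q.
have qN : (0 < q * N)%N by rewrite muln_gt0 ltnW.
have [A0 X0] : ('X_i ^+ n - 'X_l ^+ n : {mpoly k[3]}).@[w] = 0 /\ ('X_j : {mpoly k[3]}).@[w] = 0.
  by rewrite mevalB !rmorphXn /= !mevalXU wil subrr.
rewrite /dual_eq EE; split=> [|h].
  by rewrite mevalD mevalM !rmorphXn /= A0 X0 !expr0n addn1 mul0r addr0.
rewrite mderivD mderivM !mderiv_exp !mevalD !mevalM !mevalMn !mevalM !rmorphXn /= A0 X0 n1.
by rewrite !expr0n (gtn_eqF qN) (gtn_eqF (ltnW q_gt1)) addn1 /= !mul0r !mul0rn !mul0r !addr0.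
Qed.

(** The polynomial A = 1 - (u + X_t)^n vanishes at the origin and involves only
    X_t, hence A = X_t V0; its derivative - n (u + X_t)^(n-1) is a unit there, and
    so is V0.  The derivative of A^N is N A^q A', with N = 1 in the field. *)
Lemma edge_derivatives (s t : 'I_2) (u : k) (E f : {mpoly k[2]}) :
    s != t -> u ^+ n = 1 -> E@_0 != 0 ->
    f = (1 - (u%:MP + 'X_t) ^+ n) ^+ N + 'X_s ^+ n * E ->
  exists U V S, [/\ U@_0 != 0, V@_0 != 0, f^`M(t) = 'X_t ^+ q * U + 'X_s ^+ n.-1 * S &
                    f^`M(s) = 'X_s ^+ n.-1 * V].
Proof.
move=> st un E0 fE; set L : {mpoly k[2]} := u%:MP + 'X_t; set A := 1 - L ^+ n.
have u0 : u != 0.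
  by apply: contra_eq_neq un => ->; rewrite expr0n addn1 /= eq_sym oner_neq0.
have cL : L@_0 = u by rewrite /L mcoeffD mcoeffC eqxx mulr1 mcoeffX mnm1_eq0 addr0.
have cX (p : {mpoly k[2]}) d : (p ^+ d)@_0 = p@_0 ^+ d by apply: (rmorphXn (mcoeff 0%MM)).
pose V0 : {mpoly k[2]} := - \sum_(i < n) u%:MP ^+ (n.-1 - i) * L ^+ i.
have AV : A = 'X_t * V0.
  rewrite /A -[1]mpolyC1 -un (rmorphXn (@mpolyC 2 k)) /= subrXX mulrN -mulNr; congr (_ * _).
  by rewrite /L opprD addrA subrr add0r.
have cV0 : V0@_0 != 0.
  rewrite /V0 mcoeffN oppr_eq0 raddf_sum /= (eq_bigr (fun=> u ^+ n.-1)) => [|i _]; last first.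
    rewrite mul_const0 !cX cL mcoeffC eqxx mulr1 -exprD subnK //.
    by rewrite -ltnS prednK ?n_gt0.
  by rewrite sumr_const card_ord -mulr_natl natn1 // mul1r expf_neq0.
have DL i : L^`M(i) = ((t == i)%:R)%:MP.
  by rewrite /L mderivD mderivC add0r mderiv_var.
have DA i : A^`M(i) = - (L ^+ n.-1 * ((t == i)%:R)%:MP).
  by rewrite /A mderivB -[1]mpolyC1 mderivC sub0r mderiv_exp DL -mulr_natr -mpolyC_nat natn1 // mpolyC1 mulr1.
have DX i : ('X_s ^+ n : {mpoly k[2]})^`M(i) = ((s == i)%:R)%:MP * 'X_s ^+ n.-1.
  by rewrite mderiv_Xn natrM natn1 // mulr1 mul_mpolyC.
have Df i : f^`M(i) = A ^+ q * A^`M(i) + (((s == i)%:R)%:MP * 'X_s ^+ n.-1 * E + 'X_s ^+ n * E^`M(i)).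
  rewrite fE mderivD mderiv_exp mderivM DX; congr (_ + _).
  by rewrite -mulr_natr -mpolyC_nat natN1 // mpolyC1 mulr1.
have Xn : 'X_s ^+ n = 'X_s ^+ n.-1 * 'X_s :> {mpoly k[2]} by rewrite -exprSr prednK ?n_gt0.
exists (V0 ^+ q * A^`M(t)), (E + 'X_s * E^`M(s)), ('X_s * E^`M(t)); split.
- rewrite mul_const0 cX mulf_neq0 ?expf_neq0 // DA mcoeffN oppr_eq0 mul_const0 cX cL.
  by rewrite eqxx mcoeffC eqxx !mulr1 expf_neq0.
- by rewrite mcoeffD mul_const0 mcoeffX mnm1_eq0 mul0r addr0.
- by rewrite Df (negPf st) !mpolyC0 !mul0r add0r AV exprMn Xn; ring.
by rewrite Df DA (eq_sym t) (negPf st) !mpolyC0 mulr0 oppr0 mulr0 add0r eqxx mpolyC1 Xn; ring.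
Qed.

Lemma mpolyX0n d : 'X_0 ^+ d = 'X_[mon2 d 0] :> {mpoly k[2]}.
Proof.
by rewrite mpolyXn mon2_U0; congr 'X_[_]; apply: mon2P; rewrite mulmnE ?mon2_0 ?mon2_1 ?mul1n ?mul0n.
Qed.

Lemma mpolyX1n d : 'X_1 ^+ d = 'X_[mon2 0 d] :> {mpoly k[2]}.
Proof.
by rewrite mpolyXn mon2_U1; congr 'X_[_]; apply: mon2P; rewrite mulmnE ?mon2_0 ?mon2_1 ?mul1n ?mul0n.
Qed.

Lemma milnor_edge (P : P2 k) i l j : i != l -> i != j -> l != j ->
    coords P 0 i != 0 -> coords P 0 j = 0 -> coords P 0 i ^+ n = coords P 0 l ^+ n ->
  milnor_number (series2_of_mpoly (local_equation F P i)) (q ^ 2 * (q + 1)).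
Proof.
move=> il ij lj Pi Pj Pil; have qm := mpoly_pchar 2.
rewrite local_dual_eq //; set f := bh _ _ _ _.
pose u h := coords P 0 h / coords P 0 i; pose L h : {mpoly k[2]} := (u h)%:MP + chart_var k i h.
have ul : u l ^+ n = 1 by rewrite /u expr_div_n -Pil divff // expf_neq0.
have [s js | h] := unliftP i j; last by rewrite h eqxx in ij.
have [t lt | h] := unliftP i l; last by rewrite h eqxx in il.
have st : s != t by apply: contra_neq lj => st; rewrite lt js st.
have Li : L i = 1 by rewrite /L /u chart_var_self addr0 divff.
have Lj : L j = 'X_s by rewrite /L /u Pj mul0r add0r (chart_var_lift k js).
have Ll : L l = (u l)%:MP + 'X_t by rewrite /L (chart_var_lift k lt).
have [E [EE hE]] := bh_edge (mcoeff 0%MM) q_gt1 qm (fun h => L h ^+ n) il ij lj.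
have E0 : E@_0 != 0.
  have cX (p : {mpoly k[2]}) d : (p ^+ d)@_0 = p@_0 ^+ d by apply: (rmorphXn (mcoeff 0%MM)).
  have c0 (h : 'I_2) : ('X_h : {mpoly k[2]})@_0 = 0 by rewrite mcoeffX mnm1_eq0.
  case: hE => [||| -> | ->] /=.
  - by rewrite cX Li mcoeff1 eqxx expr1n.
  - by rewrite cX Ll mcoeffD c0 addr0 mcoeffC eqxx mulr1.
  - by rewrite cX Lj c0 expr0n addn1.
  - by rewrite natrX natN1 // expr1n mul1r expf_neq0 // oppr_eq0 oner_neq0.
  by rewrite oppr_eq0 oner_neq0.
rewrite Li Lj Ll expr1n in EE.
have [U [V [S [U0 V0 ft fs]]]] := edge_derivatives st ul E0 EE.
rewrite -/f in EE ft fs; have nq : (q ^ 2 * (q + 1))%N = (q * n.-1)%N.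
  by rewrite n_pred -mulnn -mulnA addn1.
have [[es et]|[es et]] : s = 0 /\ t = 1 \/ s = 1 /\ t = 0.
- case: (s) (t) st => [[|[|//]] ?] [[|[|//]] ?] // _; [left|right]; split; exact: val_inj.
- rewrite es et ?mpolyX0n ?mpolyX1n in ft fs.
  by rewrite nq mulnC; apply: (milnor_y U0 V0 ft fs).
rewrite es et ?mpolyX0n ?mpolyX1n in ft fs.
by rewrite nq; apply: (milnor_x U0 V0 ft fs).
Qed.

End MilnorPoint.

(** * The list of singular points *)
Lemma size_undup_map (S T : eqType) (f : S -> T) (s : seq S) m :
    (forall x, x \in s -> count (fun y => f y == f x) s = m) ->
  size s = (m * size (undup (map f s)))%N.
Proof.
move=> fib; rewrite -(size_map f) -(perm_size (perm_count_undup (map f s))).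
rewrite size_flatten /shape -map_comp sumnE big_map mulnC.
rewrite (eq_big_seq (fun=> m)) => [|v]; first by rewrite big_const_seq count_predT iter_addn_0 mulnC.
by rewrite mem_undup => /mapP[x xs ->]; rewrite /= size_nseq count_map -(fib x xs).
Qed.

Section Counting.
Variables (k : closedFieldType) (q : nat).
Hypotheses (q_gt1 : (1 < q)%N) (q_char : [pchar k].-nat q).

Local Notation N := q.+1.
Local Notation n := (q ^ 2 + q + 1)%N.
Local Notation F := (dual_eq k q).

(** The elements of F_(q^2) outside F_q, as the (q^2-1)-st roots of unity that are
    moved by the q-power map. *)
Definition quad_elts : seq k := [seq t <- nroots (q ^ 2).-1 1 | t ^+ q != t].

Lemma q2_gt1 : (1 < q ^ 2)%N. Proof. by rewrite -mulnn; lia. Qed.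

Lemma mem_quad_elts t : (t \in quad_elts) = (t ^+ (q ^ 2) == t) && (t ^+ q != t).
Proof.
have q2 := q2_gt1; rewrite mem_filter andbC mem_nroots -?subn1 ?subn_gt0 //.
apply: andb_id2r => tq; have t0 : t != 0.
  by apply: contra_neq tq => ->; rewrite expr0n eqn0Ngt ltnW.
by rewrite -(inj_eq (mulfI t0)) -exprS subn1 prednK ?mulr1 // ltnW.
Qed.

Lemma uniq_quad_elts : uniq quad_elts.
Proof.
rewrite filter_uniq // uniq_nroots ?oner_neq0 -?subn1 ?subn_gt0 ?q2_gt1 //.
by rewrite natrB ?(ltnW q2_gt1) // natrX natq0 // expr0n sub0r oppr_eq0 oner_neq0.
Qed.

Lemma size_quad_elts : size quad_elts = (q ^ 2 - q)%N.
Proof.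
have q2 := q2_gt1; have q2_gt0 : (0 < (q ^ 2).-1)%N by rewrite -subn1 subn_gt0.
have q1_gt0 : (0 < q.-1)%N by rewrite -subn1 subn_gt0.
rewrite size_filter; have := count_predC (fun t => t ^+ q != t) (nroots (q ^ 2).-1 (1 : k)).
rewrite size_nroots // => cnt.
suff c2 : count (predC (fun t => t ^+ q != t)) (nroots (q ^ 2).-1 (1 : k)) = q.-1.
  have arith x y : (x + q.-1 = y.-1 -> 1 < y -> x = y - q)%N by lia.
  by rewrite c2 in cnt; apply: arith cnt q2.
rewrite -size_filter -(size_nroots q1_gt0 (1 : k)); apply/perm_size/uniq_perm.
- apply: filter_uniq; apply: uniq_nroots; rewrite ?oner_neq0 // -subn1.
  by rewrite natrB ?(ltnW q2) // natrX natq0 // expr0n sub0r oppr_eq0 oner_neq0.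
- apply: uniq_nroots; rewrite ?oner_neq0 // -subn1.
  by rewrite natrB ?(ltnW q_gt1) // natq0 // sub0r oppr_eq0 oner_neq0.
move=> t; rewrite mem_filter /= negbK !mem_nroots //.
have [->|t0] := eqVneq t 0; first by rewrite !expr0n !eqn0Ngt q2_gt0 q1_gt0 /= [0 == 1]eq_sym oner_eq0 andbF.
have E d : (0 < d)%N -> (t ^+ d.-1 == 1) = (t ^+ d == t).
  by move=> d0; rewrite -(inj_eq (mulfI t0)) -exprS prednK // mulr1.
rewrite !E ?(ltnW q2) ?(ltnW q_gt1) //.
by apply: andb_idr => /eqP tq; rewrite -mulnn exprM !tq.
Qed.

Definition norm_pair (t : k) := (t ^+ N, (1 + t) ^+ N).

(** The norms of t and 1 + t determine the trace of t, hence its minimal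
    polynomial over F_q, whose roots are t and t^q. *)
Lemma norm_pair_fiber t : t \in quad_elts ->
  count (fun x => norm_pair x == norm_pair t) quad_elts = 2.
Proof.
rewrite mem_quad_elts => /andP[/eqP tq2 tq].
have N1 (x : k) : (1 + x) ^+ N = 1 + (x + x ^+ q) + x ^+ N.
  by rewrite !exprSr exprqD // expr1n; ring.
have tqq : (t ^+ q) ^+ q = t by rewrite -exprM mulnn.
have eqf : {in quad_elts, (fun x => norm_pair x == norm_pair t) =1 mem [:: t; t ^+ q]}.
  move=> x _ /=; rewrite !inE /norm_pair xpair_eqE !N1; apply/andP/orP.
    case=> /eqP nx; rewrite nx => /eqP/addIr/addrI tr.
    have : (x - t) * (x - t ^+ q) == 0.
      rewrite (_ : _ * _ = x * x - (t + t ^+ q) * x + t ^+ N); last by rewrite exprSr; ring.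
      by rewrite -tr -nx exprSr; apply/eqP; ring.
    by rewrite mulf_eq0 !subr_eq0 => /orP.
  by case=> /eqP->; rewrite ?eqxx // !exprSr tqq mulrC (addrC _ t) !eqxx.
rewrite (eq_in_count eqf) -size_filter.
rewrite (perm_size (_ : perm_eq _ [:: t; t ^+ q])) //; apply: uniq_perm.
- by rewrite filter_uniq // uniq_quad_elts.
- by rewrite /= inE eq_sym tq.
move=> x; rewrite mem_filter /= andb_idr // !inE mem_quad_elts.
by case/orP => /eqP->; rewrite ?tq2 ?tq ?eqxx // exprAC tq2 eqxx tqq eq_sym tq.
Qed.

Definition norm_pairs : seq (k * k) := undup (map norm_pair quad_elts).

Lemma size_norm_pairs : (2 * size norm_pairs)%N = (q ^ 2 - q)%N.
Proof. by rewrite -size_quad_elts; apply/esym/size_undup_map/norm_pair_fiber. Qed.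

Lemma norm_pairsP d : reflect (exists2 t, t ^+ (q ^ 2) = t /\ t ^+ q != t & d = norm_pair t)
  (d \in norm_pairs).
Proof.
rewrite mem_undup; apply: (iffP mapP) => -[t].
  by rewrite mem_quad_elts => /andP[/eqP ? ?] ->; exists t.
by case=> tq2 tq ->; exists t; rewrite // mem_quad_elts tq2 eqxx.
Qed.

Lemma norm_pairs_neq0 d : d \in norm_pairs -> d.1 != 0 /\ d.2 != 0.
Proof.
case/norm_pairsP => t [_ tq] -> /=; rewrite !expf_eq0 /=; split.
  by apply: contra_neq tq => ->; rewrite expr0n eqn0Ngt ltnW.
apply: contra_neq tq => t1; have -> : t = - 1 by apply/eqP; rewrite -addr_eq0 addrC t1.
by rewrite exprqN // expr1n.
Qed.

Definition affine_row (y z : k) : 'rV[k]_3 := \row_i nth 0 [:: 1; y; z] i.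

Lemma affine_row_neq0 y z : affine_row y z != 0.
Proof. by apply: (@row3_neq0 _ _ i0); rewrite mxE oner_neq0. Qed.

Definition affine_point y z : P2 k := point (affine_row_neq0 y z).

Lemma affine_point_inj y z y' z' : affine_point y z = affine_point y' z' -> (y, z) = (y', z').
Proof.
move/eqP/point_eqP => [c /rowP h]; have := h i0; have := h i1; have := h i2.
by rewrite !mxE /= mulr1 => -> -> <-; rewrite !mul1r.
Qed.

Definition nodes : seq (P2 k) :=
  [seq affine_point yz.1 yz.2 | d <- norm_pairs,
     yz <- [seq (y, z) | y <- nroots n d.1, z <- nroots n d.2]].

Lemma size_nodes : size nodes = (n ^ 2 * (q ^ 2 - q) %/ 2)%N.
Proof.
rewrite -size_norm_pairs mulnCA mulKn // size_allpairs_dep sumnE big_map.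
rewrite (eq_bigr (fun=> (n ^ 2)%N)) => [|d _]; first by rewrite big_const_seq count_predT iter_addn_0.
by rewrite size_allpairs !size_nroots ?n_gt0 // mulnn.
Qed.

Lemma uniq_nodes : uniq nodes.
Proof.
apply: allpairs_uniq_dep => [|d /norm_pairs_neq0[d1 d2]|].
- exact: undup_uniq.
- have u := uniq_nroots (n_gt0 q) (natn_neq0 q_gt1 q_char).
  by apply: allpairs_uniq; rewrite ?u // => -[? ?] [? ?].
move=> x x' /allpairsPdep[d [yz [dD /allpairsP[[y z] /= [yd zd ->]] ->]]].
move=> /allpairsPdep[d' [yz' [dD' /allpairsP[[y' z'] /= [yd' zd' ->]] ->]]] /=.
move=> /affine_point_inj[yy zz]; move: yd zd yd' zd'; rewrite yy zz !mem_nroots ?n_gt0 //.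
by case: d {dD} => ? ? /=; case: d' {dD'} => ? ? /= /eqP-> /eqP-> /eqP-> /eqP->.
Qed.

Lemma mem_nodes P :
  P \in nodes <-> (forall i, coords P 0 i != 0) /\ node_vec q (fun i => coords P 0 i).
Proof.
split=> [/allpairsPdep[d [yz [dD /allpairsP[[y z] /= [yd zd ->]] ->]]]|[P0 [t [c [tq2 tq h0 h1 h2]]]]].
  have [d1 d2] := norm_pairs_neq0 dD; have [t [tq2 tq] dE] := norm_pairsP _ dD.
  rewrite /= /affine_point; have [c c0 hc] := coords_point (affine_row_neq0 y z).
  rewrite !mem_nroots ?n_gt0 // in yd zd; have {yd} yd := eqP yd; have {zd} zd := eqP zd.
  have y0 : y != 0 by move: d1; rewrite -yd expf_eq0 n_gt0.
  have z0 : z != 0 by move: d2; rewrite -zd expf_eq0 n_gt0.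
  split.
    by apply: forall_ord3; rewrite hc !mxE /= mulf_neq0 ?oner_neq0.
  exists t, (c ^+ n); split=> //; rewrite hc !mxE /= exprMn ?expr1n ?mulr1 //.
    by rewrite yd dE.
  by rewrite zd dE.
pose y := coords P 0 i1 / coords P 0 i0; pose z := coords P 0 i2 / coords P 0 i0.
have c0 : c != 0 by rewrite -h0 expf_neq0.
have -> : P = affine_point y z.
  rewrite -[LHS]point_coords; apply/eqP/point_eqP; exists (coords P 0 i0); apply/rowP.
  by apply: forall_ord3; rewrite !mxE /= ?mulr1 // mulrC divfK.
apply/allpairsPdep; exists (norm_pair t), (y, z); split=> //.
  by apply/norm_pairsP; exists t.
apply/allpairsP; exists (y, z); split=> //=; rewrite mem_nroots ?n_gt0 // expr_div_n h0.
  by rewrite h1 mulrC mulKf.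
by rewrite h2 mulrC mulKf.
Qed.

Definition edge_row (j : 'I_3) (y : k) : 'rV[k]_3 :=
  \row_h if unlift j h is Some s then (if s == 0 then 1 else y) else 0.

Lemma edge_row_self j y : edge_row j y 0 j = 0.
Proof. by rewrite mxE unlift_none. Qed.
Lemma edge_row_lift j y s : edge_row j y 0 (lift j s) = if s == 0 then 1 else y.
Proof. by rewrite mxE liftK. Qed.

Lemma edge_row_neq0 j y : edge_row j y != 0.
Proof. by apply: (@row3_neq0 _ _ (lift j 0)); rewrite edge_row_lift oner_neq0. Qed.

Definition edge_point j y : P2 k := point (edge_row_neq0 j y).

Definition edge_points : seq (P2 k) :=
  [seq edge_point j y | j <- enum 'I_3, y <- nroots n 1].

Lemma size_edge_points : size edge_points = (3 * n)%N.
Proof. by rewrite size_allpairs size_enum_ord size_nroots ?n_gt0. Qed.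

Lemma uniq_edge_points : uniq edge_points.
Proof.
apply: allpairs_uniq => [||_ _ /allpairsP[[j y] /= [_ yn ->]] /allpairsP[[j' y'] /= [_ yn' ->]]].
- exact: enum_uniq.
- by rewrite uniq_nroots ?n_gt0 ?oner_neq0 // natn_neq0.
move=> /= /eqP/point_eqP[c /rowP h].
have y0 := unity_neq0 (n_gt0 q) yn.
have jj : j = j'.
  have [s js|//] := unliftP j j'; have := h j'; rewrite !mxE js liftK unlift_none mulr0.
  by move/eqP; case: ifP => _; rewrite ?oner_eq0 // (negPf y0).
have := h (lift j 0); have := h (lift j 1).
by rewrite -jj !mxE !liftK /= mulr1 => -> <-; rewrite mul1r.
Qed.

Lemma mem_edge_points P : P \in edge_points <->
  exists j, coords P 0 j = 0 /\ coords P 0 (lift j 0) ^+ n = coords P 0 (lift j 1) ^+ n.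
Proof.
split=> [/allpairsP[[j y] /= [_ yn ->]]|[j [Pj Pn]]].
  rewrite /edge_point; have [c c0 hc] := coords_point (edge_row_neq0 j y); exists j.
  have mE h : (c *: edge_row j y) 0 h = c * edge_row j y 0 h by rewrite mxE.
  rewrite hc !mE edge_row_self !edge_row_lift /= mulr0 mulr1 exprMn; split=> //.
  by move: yn; rewrite mem_nroots ?n_gt0 // => /eqP->; rewrite mulr1.
have P0 : coords P 0 (lift j 0) != 0.
  have := coords_neq0 P; apply: contraNneq => h0; apply/eqP/rowP => h; rewrite mxE.
  have h1 : coords P 0 (lift j 1) = 0.
    by apply/eqP; have /esym/eqP := Pn; rewrite h0 expr0n addn1 expf_eq0.
  have [s ->|->//] := unliftP j h.
  by case: s => [[|[|//]] ?]; [rewrite -[RHS]h0 | rewrite -[RHS]h1];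
    congr (coords P 0 (lift j _)); apply: val_inj.
apply/allpairsP; exists (j, coords P 0 (lift j 1) / coords P 0 (lift j 0)); split=> /=.
- by rewrite mem_enum.
- by rewrite mem_nroots ?n_gt0 // expr_div_n Pn divff // -Pn expf_neq0.
rewrite -[LHS]point_coords; apply/eqP/point_eqP; exists (coords P 0 (lift j 0)); apply/rowP => h.
rewrite [RHS]mxE; have [s ->|->] := unliftP j h; last by rewrite edge_row_self mulr0.
rewrite edge_row_lift; case: s => [[|[|//]] ?] /=.
  by rewrite mulr1; congr (coords P 0 (lift j _)); apply: val_inj.
by rewrite mulrC divfK //; congr (coords P 0 (lift j _)); apply: val_inj.
Qed.

End Counting.

Section Conclusion.
Variables (k : closedFieldType) (q : nat).
Hypotheses (q_gt1 : (1 < q)%N) (q_char : [pchar k].-nat q).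

Local Notation N := q.+1.
Local Notation n := (q ^ 2 + q + 1)%N.
Local Notation F := (dual_eq k q).

Lemma dual_eq_reduced : reduced_equation (dual_curve (fermat k n)) F.
Proof.
split.
- apply: contraTneq (muni_dual_eq k q).1 => ->.
  by rewrite raddf0 monicE lead_coef0 eq_sym oner_neq0.
- by exists (n * N)%N; rewrite ?muln_gt0 ?n_gt0 // dhomog_dual_eq.
- by move=> P; apply: on_curve_dual.
move=> d G G_hom GP; apply: (dual_eq_generates q_gt1 q_char G_hom) => P.
by move/(on_curve_dual q_gt1 q_char P)/GP.
Qed.

Lemma singular_pointE P : singular_point F P <->
  F.@[fun i => coords P 0 i] = 0 /\ forall i, (F^`M(i)).@[fun i => coords P 0 i] = 0.
Proof.
split=> -[FP g0]; split=> //; first by move=> i; move/rowP/(_ i): g0; rewrite !mxE.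
by apply/rowP => i; rewrite !mxE.
Qed.

Lemma lift_ord3 (j : 'I_3) : [/\ lift j 0 != lift j 1, lift j 0 != j & lift j 1 != j].
Proof. by rewrite (inj_eq lift_inj) ![_ == j]eq_sym !neq_lift. Qed.

Lemma singular_points P : singular_point F P <-> P \in nodes k q ++ edge_points k q.
Proof.
rewrite singular_pointE mem_cat; split=> [sing|/orP[/mem_nodes|/mem_edge_points]].
- have [/existsP[j /eqP Pj]|/existsPn P0] := boolP [exists j, coords P 0 j == 0]; last first.
    apply/orP; left; apply/mem_nodes => //; split=> //.
    exact/torus_singular.
  apply/orP; right; apply/mem_edge_points => //; exists j; split=> //.
  have [l01 l0j l1j] := lift_ord3 j.
  have [E [EE _]] := bh_edge idfun q_gt1 q_char (fun i => coords P 0 i ^+ n) l01 l0j l1j.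
  have := sing.1; rewrite meval_dual_eq EE Pj expr0n [X in X == 0%N]addn1 mul0r addr0 => /eqP.
  by rewrite expf_eq0 subr_eq0 => /andP[_ /eqP].
- by case=> // P0 Pnode; apply/(torus_singular q_gt1 q_char P0).
case=> // j [Pj Pn]; have [l01 l0j l1j] := lift_ord3 j.
exact: (edge_gradient q_gt1 q_char l01 l0j l1j Pj Pn).
Qed.

Lemma edge_points_milnor P : P \in edge_points k q ->
  milnor_number_at F P (q ^ 2 * (q + 1)).
Proof.
case/mem_edge_points => // j [Pj Pn] i Pi; have [l01 l0j l1j] := lift_ord3 j.
have [s is_|ij] := unliftP j i; last by rewrite ij Pj eqxx in Pi.
have [i_0|i_1] : i = lift j 0 \/ i = lift j 1.
- by rewrite is_; case: s {is_} => [[|[|//]] ?]; [left|right]; congr (lift j _); apply: val_inj.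
- by apply: (milnor_edge q_gt1 q_char (l := lift j 1) (j := j)); rewrite ?i_0 // -i_0.
apply: (milnor_edge q_gt1 q_char (l := lift j 0) (j := j)); rewrite ?i_1 // -?i_1 //.
by rewrite i_1 eq_sym.
Qed.

Lemma uniq_singular_points : uniq (nodes k q ++ edge_points k q).
Proof.
rewrite cat_uniq uniq_nodes // uniq_edge_points // andbT /=.
apply/hasPn => P /mem_edge_points[]// j [Pj _]; apply/negP => /mem_nodes[]// /(_ j).
by rewrite Pj eqxx.
Qed.

End Conclusion.

Theorem theorem2 (p e q : nat) (k : closedFieldType)
    (p_prime : prime p) (q_def : q = (p ^ e)%N) (q_gt1 : (1 < q)%N)
    (k_char : p \in [pchar k]) :
  let n := (q ^ 2 + q + 1)%N in
  let C0_dual := dual_curve (fermat k n) in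
  (forall Q : P2 k,
     C0_dual Q <-> preimage (gamma n) (ballico_hefez (k := k) q) Q) /\
  (exists F : {mpoly k[3]},
     reduced_equation C0_dual F /\
     exists nodes others : seq (P2 k),
       [/\ uniq (nodes ++ others),
           forall P : P2 k, singular_point F P <-> P \in nodes ++ others,
           size nodes = (n ^ 2 * (q ^ 2 - q) %/ 2)%N /\
             (forall P, P \in nodes -> ordinary_node_at F P)
         & size others = (3 * n)%N /\
             (forall P, P \in others ->
                milnor_number_at F P (q ^ 2 * (q + 1))%N)]).
Proof.
have q_char : [pchar k].-nat q by rewrite q_def pnatX pnatE // k_char.
move=> n C0_dual; split=> [Q|].
  by rewrite /C0_dual (on_curve_dual q_gt1 q_char) (on_curve_BH q_gt1 q_char).
exists (dual_eq k q); split; first exact: dual_eq_reduced.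
exists (nodes k q), (edge_points k q); split.
- exact: uniq_singular_points.
- exact: singular_points.
- split=> [|P /mem_nodes[]// P0 Pnode]; first exact: size_nodes.
  exact: node_at.
by split=> [|P]; [exact: size_edge_points | exact: edge_points_milnor].
Qed.
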